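(* Let $m\in\mathbb{N}$, $0<\alpha<m$, $1<p<\infty$ and $1<p_i<\infty$ for $i=1,\ldots,m$, with $1/p=1/p_1+\cdots+1/p_m$. Then the operator $I^m_\alpha$ maps $L^{p_1}(\mathbb{R})\times\cdots\times L^{p_m}(\mathbb{R})$ boundedly to $L^p((0,\infty),x^{-p\alpha}dx)$, and its operator norm equals $$\frac{1}{\Gamma(\alpha)}\int_{0<t_1,\ldots,t_m<1}\left(\prod_{i=1}^m t_i^{-1/p_i}\right)\frac{1}{|(1-t_1,\ldots,1-t_m)|^{m-\alpha}}\,dt_1\cdots dt_m.$$
   Context: $|\cdot|$ denotes the Euclidean norm on $\mathbb{R}^m$. For complex-valued measurable functions $f_1,\ldots,f_m$ on $\mathbb{R}$ and $\vec f=(f_1,\ldots,f_m)$, the (one-sided, multilinear) Riemann-Liouville operator is $$I^m_\alpha\vec f(x):=\frac{1}{\Gamma(\alpha)}\int_{0<t_1,\ldots,t_m<x}\frac{\prod_{i=1}^m f_i(t_i)}{|(x-t_1,\ldots,x-t_m)|^{m-\alpha}}\,dt_1\cdots dt_m,\qquad x>0.$$ The norm on $L^p((0,\infty),x^{-p\alpha}dx)$ is $\left(\int_0^\infty|g(x)|^p x^{-p\alpha}\,dx\right)^{1/p}$. The operator norm of a multilinear operator $T$ from $X_1\times\cdots\times X_m$ to $Y$ is the least $C$ with $\|T(\vec f)\|_Y\le C\prod_i\|f_i\|_{X_i}$ for all $f_i\in X_i$. *)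

(* Defs.v *)
From HB Require Import structures.
From mathcomp Require Import all_boot all_order all_algebra.
From mathcomp Require Import complex.
From mathcomp Require Import all_classical all_reals all_analysis.

Set Implicit Arguments.
Unset Strict Implicit.
Unset Printing Implicit Defensive.
Import Order.TTheory GRing.Theory Num.Theory.
Import numFieldNormedType.Exports.

Local Open Scope classical_set_scope.
Local Open Scope ring_scope.
Local Open Scope complex_scope.

Section prod_tuple.
Local Open Scope ereal_scope.
Context (R : realType) (d : measure_display) (T : measurableType d) (n : nat).
Variable mu1 : {sigma_finite_measure set T -> \bar R}.
Variable mun : {sigma_finite_measure set (n.-tuple T) -> \bar R}.

Definition tcons (p : T * n.-tuple T) : n.+1.-tuple T :=
  [the n.+1.-tuple T of p.1 :: p.2].

Definition tuncons (t : n.+1.-tuple T) : T * n.-tuple T :=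
  (thead t, [tuple of behead t]).

Lemma tconsK : cancel tcons tuncons.
Proof. by move=> [x t]; congr (_, _); apply/val_inj. Qed.

Lemma measurable_tcons : measurable_fun [set: T * n.-tuple T] tcons.
Proof. exact: measurable_cons. Qed.

Lemma measurable_tuncons : measurable_fun [set: n.+1.-tuple T] tuncons.
Proof.
apply/measurable_fun_pairP; split; first exact: measurable_tnth.
exact: measurable_behead.
Qed.

(* The product measure on T * T^n, transported to T^n.+1. *)
Definition prod_tuple := pushforward (mu1 \x mun) tcons.

Let measurable_preimage A : measurable A -> measurable (tcons @^-1` A).
Proof. by move=> mA; rewrite -[X in measurable X]setTI; exact: measurable_tcons. Qed.

Let prod_tuple0 : prod_tuple set0 = 0.
Proof. by rewrite /prod_tuple /pushforward preimage_set0 measure0. Qed.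

Let prod_tuple_ge0 A : 0 <= prod_tuple A.
Proof. exact: (measure_ge0 (mu1 \x mun)). Qed.

Let prod_tuple_sigma_additive : semi_sigma_additive prod_tuple.
Proof.
move=> F mF tF mUF; rewrite /prod_tuple /pushforward preimage_bigcup.
apply: (@measure_semi_sigma_additive _ _ _ (mu1 \x mun)).
- by move=> i; exact: measurable_preimage.
- apply/trivIsetP => /= i j _ _ ij; rewrite -preimage_setI.
  by move/trivIsetP : tF => /(_ _ _ _ _ ij) ->//; rewrite preimage_set0.
- by rewrite -preimage_bigcup; exact: measurable_preimage.
Qed.

HB.instance Definition _ := isMeasure.Build _ _ _ prod_tuple
  prod_tuple0 prod_tuple_ge0 prod_tuple_sigma_additive.

Let prod_tuple_sigma_finite : sigma_finite setT prod_tuple.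
Proof.
have /sigma_finiteP[F [TF ndF Foo]] := sigma_finiteT mu1.
have /sigma_finiteP[G [TG ndG Goo]] := sigma_finiteT mun.
exists (fun i => tuncons @^-1` (F i `*` G i)).
  rewrite -preimage_bigcup (_ : \bigcup_i _ = setT) ?preimage_setT//.
  rewrite -setXTT TF TG predeqE => -[x y]; split.
    by move=> [i _ []/= ? ?]; split; exists i.
  move=> [/= [i _ Fix] [k _ Gky]]; exists (maxn i k) => //; split.
  - by move: x Fix; exact/subsetPset/ndF/leq_maxl.
  - by move: y Gky; exact/subsetPset/ndG/leq_maxr.
move=> i; have [mF Fi] := Foo i; have [mG Gi] := Goo i; split.
  rewrite -[X in measurable X]setTI; apply: measurable_tuncons => //.
  exact: measurableX.
rewrite /prod_tuple /pushforward (_ : _ @^-1` _ = F i `*` G i); last first.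
  by apply/funext => p; rewrite /preimage /mkset tconsK.
by rewrite product_measure1E// lte_mul_pinfty// ge0_fin_numE.
Qed.

HB.instance Definition _ := Measure_isSigmaFinite.Build _ _ _ prod_tuple
  prod_tuple_sigma_finite.

End prod_tuple.

Section lebesgue_tuple.
Context (R : realType).

Fixpoint lebesgue_tuple (n : nat) :
    {sigma_finite_measure set (n.-tuple (measurableTypeR R)) -> \bar R} :=
  match n with
  | 0 => \d_([tuple] : 0.-tuple (measurableTypeR R))
  | n'.+1 => prod_tuple lebesgue_measure (lebesgue_tuple n')
  end.

Lemma measurable_box (n : nat) (A : 'I_n -> set (measurableTypeR R)) :
  (forall i, measurable (A i)) ->
  measurable [set t : n.-tuple (measurableTypeR R) | forall i, A i (tnth t i)].
Proof.
move=> mA; rewrite [X in measurable X](_ : _ =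
  \bigcap_(i in [set: 'I_n]) ((@tnth n (measurableTypeR R))^~ i @^-1` A i)).
  apply: fin_bigcap_measurable => // i _.
  by rewrite -[X in measurable X]setTI; exact: measurable_tnth.
by apply/seteqP; split=> t /= h i; [move=> _|]; exact: h.
Qed.

Lemma lebesgue_tuple_box (n : nat) (A : 'I_n -> set (measurableTypeR R)) :
  (forall i, measurable (A i)) ->
  lebesgue_tuple n [set t | forall i, A i (tnth t i)] =
  (\prod_(i < n) lebesgue_measure (A i))%E.
Proof.
elim: n A => [|n ih] A mA.
  rewrite big_ord0 /= /dirac indicE mem_set// => -[]//.
rewrite big_ord_recl -ih//= /prod_tuple /pushforward -product_measure1E//=; last first.
  exact: (measurable_box (fun i => mA (lift ord0 i))).
congr (product_measure1 _ _ _); apply/seteqP; split=> -[x t] /=.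
  move=> h; split; first exact: (h ord0).
  by move=> i; have := h (lift ord0 i); rewrite tnthS.
move=> [h0 h] i; case: (unliftP ord0 i) => [j|] ->; last exact: h0.
by rewrite tnthS.
Qed.

End lebesgue_tuple.


Section complex_valued.
Context (R : realType) (d : measure_display) (T : measurableType d).
Implicit Types (mu : {measure set T -> \bar R}) (D : set T)
  (g : T -> R[i]).

(* |z| as an element of R; the norm `|z| of the ring R[i] is R[i]-valued. *)
Definition cabs (z : R[i]) : R := ComplexField.Normc.normc z.

Definition cmeasurable D g :=
  measurable_fun D (fun x => complex.Re (g x)) /\
  measurable_fun D (fun x => complex.Im (g x)).

Definition cintegrable mu D g :=
  mu.-integrable D (fun x => (complex.Re (g x))%:E) /\
  mu.-integrable D (fun x => (complex.Im (g x))%:E).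

(* Total, with a meaningless value unless [cintegrable mu D g] holds. *)
Definition cintegral mu D g : R[i] :=
  (\int[mu]_(x in D) complex.Re (g x)) +i*
  (\int[mu]_(x in D) complex.Im (g x)).

End complex_valued.

Section Riemann_Liouville.
Context (R : realType).
Local Notation C := (R[i]).
Local Notation leb := (@lebesgue_measure R).

Definition Gamma (a : R) : R :=
  \int[leb]_(t in `]0, +oo[) (t `^ (a - 1) * expR (- t)).

Definition Lp_norm (p : R) (f : R -> C) : \bar R :=
  'N[leb]_(p%:E)[EFin \o (@cabs R) \o f].

Definition in_Lp (p : R) (f : R -> C) :=
  @cmeasurable R _ (measurableTypeR R) setT f /\ (Lp_norm p f < +oo)%E.

Definition wLp_norm (p alpha : R) (g : R -> C) : \bar R :=
  ((\int[leb]_(x in `]0%R, +oo[)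
      (cabs (g x) `^ p * x `^ (- (p * alpha)))%:E) `^ p^-1)%E.

Definition in_wLp (p alpha : R) (g : R -> C) :=
  @cmeasurable R _ (measurableTypeR R) `]0, +oo[ g /\ (wLp_norm p alpha g < +oo)%E.

Definition enorm (m : nat) (v : 'I_m -> R) : R :=
  Num.sqrt (\sum_(i < m) v i ^+ 2).

Definition cube (m : nat) (x : R) : set (m.-tuple (measurableTypeR R)) :=
  [set t | forall i, 0 < tnth t i < x].

Definition RL_kernel (m : nat) (alpha x : R) (t : m.-tuple R) : R :=
  (enorm (fun i => x - tnth t i) `^ (m%:R - alpha))^-1.

Definition RL_integrand (m : nat) (alpha : R) (f : 'I_m -> R -> C) (x : R)
    (t : m.-tuple R) : C :=
  (\prod_(i < m) f i (tnth t i)) * (RL_kernel alpha x t)%:C.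

Definition RL (m : nat) (alpha : R) (f : 'I_m -> R -> C) (x : R) : C :=
  ((Gamma alpha)^-1)%:C *
  cintegral (lebesgue_tuple R m) (@cube m x) (RL_integrand alpha f x).

Definition operator_bounds (m : nat) (ps : 'I_m -> R)
    (normY : (R -> C) -> \bar R) (T : ('I_m -> R -> C) -> R -> C) : set R :=
  [set K | forall f, (forall i, in_Lp (ps i) (f i)) ->
    (normY (T f) <= K%:E * \prod_(i < m) Lp_norm (ps i) (f i))%E].

Definition is_operator_norm (m : nat) (ps : 'I_m -> R)
    (normY : (R -> C) -> \bar R) (T : ('I_m -> R -> C) -> R -> C) (K : R) :=
  operator_bounds ps normY T K /\ lbound (operator_bounds ps normY T) K.

(* Valued in \bar R, so that equality with a real number asserts convergence. *)
Definition RL_constant (m : nat) (alpha : R) (ps : 'I_m -> R) : \bar R :=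
  (((Gamma alpha)^-1)%:E *
   \int[lebesgue_tuple R m]_(t in @cube m 1)
     ((\prod_(i < m) tnth t i `^ (- (ps i)^-1)) * RL_kernel alpha 1 t)%:E)%E.

End Riemann_Liouville.

(* Main.v *)
(**
  The kernel is homogeneous: substituting [t = x s] gives
  [x^-alpha I f(x) = c * \int_(0 < s_i < 1) \prod_i f_i(x s_i) k(s) ds] with
  [k(s) = |1 - s|^(alpha - m)] and [c = 1 / Gamma alpha].  Let
  [W(s) = \prod_i s_i^(-1/p_i) k(s)] and [A = \int W]; [A] is finite because
  [k(s) <= \prod_i (1 - s_i)^(-(m - alpha)/m)].
  Upper bound: Jensen's inequality for the measure [W ds / A] bounds
  [(x^-alpha I f(x))^p] by [A^(p-1) \int \prod_i (s_i^(1/p_i) |f_i(x s_i)|)^p W(s) ds];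
  after normalising the [f_i], weighted AM-GM with weights [p / p_i] and
  Tonelli reduce the integral in [x] to the norms of the dilates of the [f_i].
  Lower bound: for [f_i(t) = t^(-(1+e)/p_i) 1_(t >= 1)] and [x >= l >= 1],
  [x^-alpha I f(x) >= c x^(-(1+e)/p) \int_(s_i >= 1/l) W], so the operator norm is
  at least [c l^(-e/p) \int_(s_i >= 1/l) W]; let [e] tend to 0 and then [l] to infinity.
*)

Require Import Defs.
From mathcomp Require Import all_boot all_order all_algebra.
From mathcomp Require Import complex.
From mathcomp Require Import all_classical all_reals all_analysis.
From mathcomp Require Import measurable_realfun ring lra.

Set Implicit Arguments.
Unset Strict Implicit.
Unset Printing Implicit Defensive.
Import Order.TTheory GRing.Theory Num.Theory.
Import numFieldNormedType.Exports.

Local Open Scope classical_set_scope.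
Local Open Scope ring_scope.
Local Open Scope complex_scope.

(** * Affine substitutions on the line *)

Section lebesgue_affine.
Context (R : realType).
Local Notation leb := (@lebesgue_measure R).
Local Open Scope ereal_scope.

Let aff (a b : R) : R -> measurableTypeR R := fun t => (a * t + b)%R.

Let measurable_aff a b : measurable_fun [set: measurableTypeR R] (aff a b).
Proof. by apply: measurable_funD => //; apply: measurable_funM. Qed.

(* The measure structure of a pushforward is named because the measurability
   proof it takes as argument cannot be inferred. *)
Let pf a b : {measure set (measurableTypeR R) -> \bar R} :=
  measure_function_pushforward__canonical__measure_function_Measure leb
    (measurable_aff a b).

(** By uniqueness of Lebesgue measure it suffices that the rescaled image measure agrees with length
    on the intervals []u, v]]. *)
Lemma lebesgue_measure_affine (a b : R) (A : set R) : a != 0%R -> measurable A ->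
  `|a|%:E * leb (aff a b @^-1` A) = leb A.
Proof.
move=> a0 mA.
have na0 : (0 < `|a|)%R by rewrite normr_gt0.
transitivity (mscale (NngNum (normr_ge0 a)) (pf a b) A); first by [].
apply/esym/lebesgue_measure_unique => //= _ [[u v]] _ <-.
rewrite /mscale /= /pushforward.
have [alt|agt|/eqP] := ltgtP a 0%R; last by rewrite (negbTE a0).
  (* A negative slope reverses the order, so the closed end changes sides. *)
  rewrite (_ : aff a b @^-1` _ = `[(v - b) / a, (u - b) / a[%classic)%R; last first.
    apply/seteqP; split => x /=; rewrite !in_itv /= /aff;
      rewrite ler_ndivrMr // ltr_ndivlMr // lerBrDr ltrBlDr mulrC andbC //.
  rewrite !lebesgue_measure_itv /= !lte_fin.
  rewrite ltr_ndivrMr // divfK // ltrD2r.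
  case: ifPn => uv; last by rewrite mule0.
  rewrite -!EFinD -EFinM -mulrBl ltr0_norm//; congr EFin.
  by field; exact/eqP/eqP.
rewrite (_ : aff a b @^-1` _ = `](u - b) / a, (v - b) / a]%classic)%R; last first.
  apply/seteqP; split => x /=; rewrite !in_itv /= /aff;
    rewrite ler_pdivlMr // ltr_pdivrMr // lerBrDr ltrBlDr mulrC //.
rewrite !lebesgue_measure_itv /= !lte_fin.
rewrite ltr_pdivrMr // divfK // ltrD2r.
case: ifPn => uv; last by rewrite mule0.
rewrite -!EFinD -EFinM -mulrBl gtr0_norm//; congr EFin.
by field; exact/eqP/eqP.
Qed.

(** Used with [b = 0] for dilations and with [a = -1], [b = 1] for the reflection [t |-> 1 - t]. *)
Lemma ge0_integral_affine (a b : R) (g : R -> \bar R) : a != 0%R ->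
  measurable_fun [set: R] g -> (forall t, 0 <= g t) ->
  `|a|%:E * \int[leb]_t g (a * t + b)%R = \int[leb]_t g t.
Proof.
move=> a0 mg g0.
transitivity (`|a|%:E * \int[pf a b]_t g t).
  by rewrite ge0_integral_pushforward//; exact: measurable_aff.
rewrite -(@ge0_integral_mscale _ _ _ (pf a b) setT measurableT
  (NngNum (normr_ge0 a)))//.
by apply: eq_measure_integral => A mA _; exact: lebesgue_measure_affine.
Qed.

End lebesgue_affine.

(** * Integration over tuples: Tonelli, dilations, products *)

Section lebesgue_tuple_integral.
Context (R : realType).
Local Notation TR := (measurableTypeR R).
Local Notation leb := (@lebesgue_measure R).
Local Open Scope ereal_scope.

Lemma ge0_integral_lebesgue_tuple0 (G : 0.-tuple TR -> \bar R) :
  measurable_fun setT G -> (forall t, 0 <= G t) ->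
  \int[lebesgue_tuple R 0]_t G t = G [tuple].
Proof. by move=> mG G0; rewrite /= integral_dirac// diracT mul1e. Qed.

(** The measure on [n.+1]-tuples is the image of a product measure under [tcons], so Tonelli applies
    after a change of variables. *)
Lemma ge0_integral_lebesgue_tupleS n (G : n.+1.-tuple TR -> \bar R) :
  measurable_fun setT G -> (forall t, 0 <= G t) ->
  \int[lebesgue_tuple R n.+1]_t G t =
  \int[leb]_x \int[lebesgue_tuple R n]_t G (tcons (x, t)).
Proof.
move=> mG G0.
have mc := @measurable_tcons _ TR n.
transitivity (\int[measure_function_pushforward__canonical__measure_function_Measure
    (leb \x lebesgue_tuple R n) mc]_t G t); first exact: eq_measure_integral.
rewrite (ge0_integral_pushforward mc)// preimage_setT fubini_tonelli1//.
  exact: measurableT_comp.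
by move=> p; exact: G0.
Qed.

Lemma measurable_fun_tcons n (x : TR) :
  measurable_fun [set: n.-tuple TR] (fun t => tcons (x, t)).
Proof.
by apply: measurableT_comp (@measurable_tcons _ TR n) _; exact: measurable_pair1.
Qed.

Definition tuple_scale n (a : R) (t : n.-tuple TR) : n.-tuple TR :=
  [tuple (a * tnth t i)%R | i < n].

Lemma measurable_tuple_scale n a : measurable_fun setT (@tuple_scale n a).
Proof.
apply/measurable_fun_tnthP => i.
rewrite (_ : _ \o _ = fun t : n.-tuple TR => (a * tnth t i)%R); last first.
  by apply/funext => t /=; rewrite tnth_mktuple.
by apply: measurable_funM => //; exact: measurable_tnth.
Qed.

Lemma tuple_scale_tcons n a x (t : n.-tuple TR) :
  tuple_scale a (tcons (x, t)) = tcons ((a * x)%R, tuple_scale a t).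
Proof.
apply: eq_from_tnth => i; rewrite tnth_mktuple.
by case: (unliftP ord0 i) => [j|] ->; rewrite ?tnthS ?tnth_mktuple.
Qed.

(** Induction on the dimension: each coordinate contributes one factor [a] through the
    one-dimensional substitution. *)
Lemma ge0_integral_tuple_scale n (a : R) (G : n.-tuple TR -> \bar R) :
  (0 < a)%R -> measurable_fun setT G -> (forall t, 0 <= G t) ->
  (a ^+ n)%:E * \int[lebesgue_tuple R n]_t G (tuple_scale a t) =
  \int[lebesgue_tuple R n]_t G t.
Proof.
move=> a0; elim: n G => [|n ih] G mG G0.
  rewrite !ge0_integral_lebesgue_tuple0//; last first.
    exact: (measurableT_comp mG (measurable_tuple_scale _)).
  by rewrite expr0 mul1e; congr G; exact: tuple0.
have mGa := measurableT_comp mG (measurable_tuple_scale a).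
rewrite !ge0_integral_lebesgue_tupleS//.
pose F (x : R) := \int[lebesgue_tuple R n]_t G (tcons (x, t)).
have F0 x : 0 <= F x by apply: integral_ge0 => t _; exact: G0.
have mF : measurable_fun [set: R] F.
  apply: (@measurable_fun_fubini_tonelli_F _ _ _ _ _ (lebesgue_tuple R n)
    (fun p => G (tcons p))) => //.
  exact: (measurableT_comp mG (@measurable_tcons _ TR n)).
(* Dilation of the first coordinate alone, applied to the inner integral [F]; the induction
   hypothesis handles the others. *)
have := @ge0_integral_affine R a 0%R F (lt0r_neq0 a0) mF F0.
rewrite (gtr0_norm a0) => <-.
rewrite exprS EFinM -muleA; apply: (congr1 (fun z => a%:E * z)).
rewrite -ge0_integralZl_EFin//; last 3 first.
- by move=> x _; apply: integral_ge0 => t _; exact: G0.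
- apply: (@measurable_fun_fubini_tonelli_F _ _ _ _ _ (lebesgue_tuple R n)
    (fun p => G (tuple_scale a (tcons p)))) => //.
  exact: (measurableT_comp mGa (@measurable_tcons _ TR n)).
- by rewrite exprn_ge0// ltW.
apply: eq_integral => x _; rewrite addr0 /F.
rewrite -(ih (fun t => G (tcons ((a * x)%R, t))))//.
  by congr (_ * _); apply: eq_integral => t _; rewrite tuple_scale_tcons.
exact: (measurableT_comp mG (measurable_fun_tcons _)).
Qed.

Lemma ge0_integral_lebesgue_tuple_prod n (g : 'I_n -> R -> R) :
  (forall i, measurable_fun setT (g i)) -> (forall i t, 0 <= g i t)%R ->
  \int[lebesgue_tuple R n]_t (\prod_(i < n) g i (tnth t i))%:E =
  \prod_(i < n) \int[leb]_x (g i x)%:E.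
Proof.
have mprod k (f : 'I_k -> R -> R) : (forall i, measurable_fun setT (f i)) ->
    measurable_fun setT (fun t : k.-tuple TR => (\prod_(i < k) f i (tnth t i))%:E).
  move=> mf; apply/measurable_EFinP; apply: measurable_prod => i _.
  by apply: measurableT_comp (measurable_tnth _); exact: mf.
elim: n g => [|n ih] g mg g0.
  rewrite ge0_integral_lebesgue_tuple0 ?big_ord0//; first exact: mprod.
  by move=> t; rewrite lee_fin big_ord0.
rewrite ge0_integral_lebesgue_tupleS; last by move=> t; rewrite lee_fin prodr_ge0.
  2: exact: mprod.
rewrite big_ord_recl -ih//.
rewrite -ge0_integralZr//; last 3 first.
- by apply/measurable_EFinP; exact: mg.
- by move=> x _; rewrite lee_fin.
- by apply: integral_ge0 => t _; rewrite lee_fin prodr_ge0.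
apply: eq_integral => x _.
rewrite -ge0_integralZl_EFin//; last 2 first.
- by move=> t _; rewrite lee_fin prodr_ge0.
- exact: (mprod n (fun i => g (lift ord0 i))).
apply: eq_integral => t _; rewrite -EFinM big_ord_recl; congr (_ * _)%:E.
by apply: eq_bigr => i _; rewrite tnthS.
Qed.

End lebesgue_tuple_integral.

(** * Integrals of powers near infinity and near zero *)

Section power_integrals.
Context (R : realType).
Local Notation leb := (@lebesgue_measure R).

Lemma continuous_powR (a x : R) : 0 < x -> {for x, continuous (fun y : R => y `^ a)}.
Proof.
move=> x0; apply: differentiable_continuous; apply/derivable1_diffP.
by apply: derivable_powR; rewrite in_itv/= x0.
Qed.

(** Fundamental theorem of calculus on a half-line; the antiderivative [- x^(-e) / e] vanishes at
    infinity. *)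
Lemma integral_powR_itvy (l e : R) : 0 < l -> 0 < e ->
  (\int[leb]_(x in `[l, +oo[) (x `^ (- (1 + e)))%:E = (e^-1 * l `^ (- e))%:E)%E.
Proof.
move=> l0 e0; have ne0 : e != 0 by rewrite gt_eqF.
pose F (x : R) : R := - e^-1 * x `^ (- e).
have dF (x : R) : 0 < x -> is_derive x 1 F (x `^ (- (1 + e))).
  move=> x0; have ? := @is_derive1_powR R (- e) x x0.
  apply: is_derive_eq; rewrite /GRing.scale /= -opprD addrC.
  by rewrite mulrA mulrNN mulVf// mul1r.
rewrite (@ge0_continuous_FTC2y R (fun x => x `^ (- (1 + e))) F l 0).
- by rewrite /F -EFinB mulNr opprK add0r.
- by move=> x _; exact: powR_ge0.
- apply: continuous_in_subspaceT => x; rewrite inE => /itvP x1.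
  by apply: continuous_powR; rewrite (lt_le_trans l0)// x1.
- rewrite -[X in _ --> X](mulr0 (- e^-1)); apply: cvgM; first exact: cvg_cst.
  apply/cvgr0Pnorm_lt => eps eps0.
  (* Beyond this threshold [x^(-e)] is below [eps]. *)
  have M0 : 0 < eps `^ (- e^-1) by rewrite powR_gt0.
  near=> x.
  have Mx : eps `^ (- e^-1) < x by near: x; exact: nbhs_pinfty_gt.
  rewrite ger0_norm ?powR_ge0// powRN invf_plt ?posrE ?powR_gt0 ?(lt_trans M0 Mx)//.
  have := @gt0_ltr_powR R e e0 _ _ _ _ Mx; rewrite !nnegrE !ltW ?(lt_trans M0 Mx)//.
  by rewrite -powRrM mulNr mulVf// powR_inv1 ?(ltW eps0)//; apply.
- by move=> x x1; have [] := dF x (lt_trans l0 x1).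
- apply: cvg_at_right_filter; apply: differentiable_continuous.
  by apply/derivable1_diffP; have [] := dF l l0.
- move=> x /itvP x1; rewrite derive1E.
  by have [] : is_derive x 1 F (x `^ (- (1 + e)))
    by apply: dF; rewrite (lt_trans l0)// x1.
Unshelve. all: by end_near.
Qed.

(** A possible singularity at 0 is avoided by working on [[1/(n+2), 1]], where the integral is at
    most [1/(1-a)] uniformly in [n]; monotone convergence does the rest. *)
Lemma integral_powR_itv01 (a : R) : a < 1 ->
  (\int[leb]_(x in `]0%R, 1%R]) (x `^ (- a))%:E < +oo)%E.
Proof.
move=> a1; have a0 : 0 < 1 - a by rewrite subr_gt0.
have na0 : 1 - a != 0 by rewrite gt_eqF.
pose F (x : R) : R := (1 - a)^-1 * x `^ (1 - a).
have dF (x : R) : 0 < x -> is_derive x 1 F (x `^ (- a)).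
  move=> x0; have ? := @is_derive1_powR R (1 - a) x x0.
  apply: is_derive_eq; rewrite /GRing.scale /= mulKf//.
  by congr (_ `^ _); ring.
(* Starting at [n.+2] keeps the left endpoint strictly below 1. *)
have FTC (n : nat) :
    (\int[leb]_(x in `[n.+2%:R^-1%R, 1%R]) (x `^ (- a))%:E <= ((1 - a)^-1)%:E)%E.
  have n0 : 0 < n.+2%:R^-1 :> R by rewrite invr_gt0.
  rewrite (@continuous_FTC2 R (fun x => x `^ (- a)) F).
  - rewrite -EFinB lee_fin /F powR1 mulr1 lerBlDr lerDl mulr_ge0 ?powR_ge0//.
    by rewrite invr_ge0 ltW.
  - by rewrite invf_lt1// ltr1n.
  - apply: continuous_in_subspaceT => x; rewrite inE => /itvP x1.
    by apply: continuous_powR; rewrite (lt_le_trans n0)// x1.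
  - have cF x : 0 < x -> {for x, continuous F}.
      move=> x0; apply: differentiable_continuous.
      by apply/derivable1_diffP; have [] := dF x x0.
    split.
    + move=> x; rewrite in_itv/= => /andP[x1 _].
      by have [] := dF x (lt_trans n0 x1).
    + by apply: cvg_at_right_filter; exact: cF.
    + by apply: cvg_at_left_filter; exact: cF.
  - move=> x /itvP x1; rewrite derive1E.
    by have [] : is_derive x 1 F (x `^ (- a)) by apply: dF; rewrite (lt_trans n0)// x1.
have -> : `]0%R, 1%R]%classic = \bigcup_n `[n.+2%:R^-1 : R, 1]%classic.
  apply/seteqP; split => [x /=|x [n _] /=]; rewrite !in_itv/= => /andP[x0 x1].
    have [n _ nx] := near_infty_natSinv_lt (PosNum x0).
    exists n => //=; rewrite in_itv/= x1 andbT.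
    have := ltW (nx n (leqnn n)); apply: le_trans.
    by rewrite lef_pV2 ?posrE// ler_nat.
  by rewrite x1 (lt_le_trans _ x0)// invr_gt0.
apply: (@le_lt_trans _ _ ((1 - a)^-1)%:E); last exact: ltry.
have mpow D : measurable_fun D (fun x : R => (x `^ (- a))%:E).
  by apply/measurable_EFinP/measurable_funTS; exact: measurable_powR.
pose E (n : nat) : set R := `[n.+2%:R^-1, 1]%classic.
have cv : (\int[leb]_(x in E n) (x `^ (- a))%:E @[n --> \oo] -->
    \int[leb]_(x in \bigcup_n E n) (x `^ (- a))%:E)%E.
  apply: ge0_nondecreasing_set_cvg_integral => //.
  - move=> i j ij; apply/subsetPset => x /=; rewrite /E/= !in_itv/= => /andP[x0 ->].
    by rewrite andbT (le_trans _ x0)// lef_pV2 ?posrE// ler_nat.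
  - by move=> i; exact: measurable_itv.
  - by move=> i; exact: mpow.
  - by move=> i x _; rewrite lee_fin powR_ge0.
rewrite -(cvg_lim _ cv)//; apply: lime_le; last exact: nearW.
by apply: cvgP; exact: cv.
Qed.

End power_integrals.

(** * Jensen's inequality with a weight *)

Section weighted_jensen.
Context d (T : measurableType d) (R : realType) (mu : {measure set T -> \bar R}).
Local Open Scope ereal_scope.

Lemma ge0_integral_EFinZl (c : R) (h : T -> R) : (0 <= c)%R ->
  measurable_fun setT h -> (forall t, 0 <= h t)%R ->
  \int[mu]_t (c * h t)%:E = c%:E * \int[mu]_t (h t)%:E.
Proof.
move=> c0 mh h0; under eq_integral do rewrite EFinM.
by rewrite ge0_integralZl_EFin//; [move=> t _; rewrite lee_fin|exact/measurable_EFinP].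
Qed.

(** Hoelder with exponents [p] and [q], applied to [F W^(1/p)] and [W^(1/q)]. Multiplying by a power
    of the total mass [A], instead of normalising [W], covers [A = 0] as well. *)
Lemma hoelder_weight (p A : R) (F W : T -> R) : (1 < p)%R ->
  measurable_fun setT F -> measurable_fun setT W ->
  (forall x, 0 <= F x)%R -> (forall x, 0 <= W x)%R ->
  \int[mu]_x (W x)%:E = A%:E ->
  (\int[mu]_x (F x * W x)%:E) `^ p <=
  (A `^ (p - 1))%:E * \int[mu]_x (F x `^ p * W x)%:E.
Proof.
move=> p1 mF mW F0 W0 intW.
have p0 : (0 < p)%R by rewrite (lt_trans ltr01).
pose q := ((1 - p^-1)^-1)%R.
have q0 : (0 < q)%R by rewrite invr_gt0 subr_gt0 invf_lt1.
have pq : (p^-1 + q^-1 = 1)%R by rewrite /q invrK; ring.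
have mf : measurable_fun setT (fun x => F x * W x `^ p^-1)%R.
  apply: measurable_funM => //.
  exact: (measurableT_comp (measurable_powR _)).
have mg : measurable_fun setT (fun x => W x `^ q^-1)%R.
  exact: (measurableT_comp (measurable_powR _)).
have := hoelder mu mf mg p0 q0 pq.
move=> /(gt0_ler_poweR (ltW p0)); 
rewrite !in_itv/= !leey !Lnorm_ge0/= mule_ge0 ?Lnorm_ge0//.
move=> /(_ isT isT); rewrite poweRM ?Lnorm_ge0// poweR_Lnorm ?gt_eqF// Lnorm1.
(* Since [1/p + 1/q = 1], the two factors recombine into [F W]. *)
under eq_integral.
  move=> x _; rewrite /= -mulrA -powRD ?pq ?oner_eq0// powRr1// ger0_norm ?mulr_ge0//.
  over.
move=> /le_trans; apply; rewrite muleC; apply: lee_pmul.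
- exact: poweR_ge0.
- by apply: integral_ge0 => x _; exact: poweR_ge0.
- rewrite unlock -poweRrM.
  under eq_integral.
    move=> x _; rewrite /= ger0_norm ?powR_ge0// -powRrM mulVf ?gt_eqF// powRr1//.
    over.
  rewrite intW /= lee_fin (_ : (q^-1 * p = p - 1)%R)//.
  by rewrite /q invrK mulrBl mul1r mulVf// gt_eqF.
- apply: ge0_le_integral => //.
  + by move=> x _; exact: poweR_ge0.
  + by apply: (measurableT_comp (measurable_poweR _));
      apply: measurableT_comp => //; exact/measurable_EFinP.
  + apply/measurable_EFinP; apply: measurable_funM => //.
    exact: (measurableT_comp (measurable_powR _)).
  + move=> x _; rewrite /= lee_fin ger0_norm ?mulr_ge0 ?powR_ge0//.
    by rewrite powRM ?powR_ge0// -powRrM mulVf ?gt_eqF// powRr1.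
Qed.

End weighted_jensen.

(** * Finiteness of Beta integrals *)

Section beta_integral.
Context (R : realType).
Local Notation leb := (@lebesgue_measure R).

(** Each half of the interval touches only one singularity; the other factor is bounded there by
    [2^a] or [2^b]. *)
Lemma integral_beta_lty (a b : R) : 0 <= a < 1 -> 0 <= b < 1 ->
  (\int[leb]_t (\1_(`]0%R, 1%R[%classic : set R) t *
    (t `^ (- a) * (1 - t) `^ (- b)))%:E < +oo)%E.
Proof.
move=> /andP[a0 a1] /andP[b0 b1].
pose f c (t : R) : R := \1_(`]0%R, 1%R]%classic : set R) t * t `^ (- c).
have f0 c t : 0 <= f c t by rewrite /f mulr_ge0// powR_ge0.
have mf c : measurable_fun setT (f c).
  apply: measurable_funM; last exact: measurable_powR.
  by apply: measurable_indic; exact: measurable_itv.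
have intf c : c < 1 -> (\int[leb]_t (f c t)%:E < +oo)%E.
  move=> /integral_powR_itv01; rewrite integral_mkcond.
  congr (_ < _)%E; apply: eq_integral => t _.
  rewrite patchE /f indicE; case: ifPn => _; by rewrite ?mul1r ?mul0r.
have pow2 c (u : R) : 0 <= c -> 2^-1 <= u -> u `^ (- c) <= 2 `^ c.
  move=> c0 u2; have u0 : 0 < u by rewrite (lt_le_trans _ u2).
  rewrite powRN -[leRHS]invrK lef_pV2 ?posrE ?invr_gt0 ?powR_gt0//.
  by rewrite -powRN -mulN1r powRrM powR_inv1// ge0_ler_powR// nnegrE ltW.
(* The first summand dominates for [t <= 1/2], the second for [t > 1/2]. *)
pose g t : R := 2 `^ b * f a t + 2 `^ a * f b (1 - t).
have mf1 : measurable_fun setT (fun t : R => f b (1 - t)).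
  by apply: (measurableT_comp (mf b)); apply: measurable_funB.
apply: (@le_lt_trans _ _ (\int[leb]_t (g t)%:E)%E).
  apply: ge0_le_integral => //.
  - by move=> t _; rewrite lee_fin !mulr_ge0// powR_ge0.
  - apply/measurable_EFinP; apply: measurable_funM.
      by apply: measurable_indic; exact: measurable_itv.
    apply: measurable_funM; first exact: measurable_powR.
    apply: (measurableT_comp (measurable_powR _)); exact: measurable_funB.
  - apply/measurable_EFinP; rewrite /g; apply: measurable_funD; apply: measurable_funM;
      [exact: measurable_cst|exact: mf|exact: measurable_cst|exact: mf1].
  - move=> t _; rewrite lee_fin indicE; case: (boolP (t \in _)); last first.
      by rewrite mul0r addr_ge0// mulr_ge0// powR_ge0.
    rewrite inE/= in_itv/= => /andP[t0 t1]; rewrite mul1r /g.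
    have t'0 : 0 < 1 - t by rewrite subr_gt0.
    have [t2|t2] := lerP t 2^-1.
      apply: ler_wpDr; first by rewrite mulr_ge0// powR_ge0.
      rewrite /f indicE mem_set ?mul1r /=; last by rewrite in_itv/= t0 ltW.
      by rewrite mulrC ler_wpM2r ?powR_ge0// pow2//; lra.
    apply: ler_wpDl; first by rewrite mulr_ge0// powR_ge0.
    rewrite /f indicE mem_set ?mul1r /=; last by rewrite in_itv/=; lra.
    by rewrite ler_wpM2r ?powR_ge0// pow2// ltW.
under eq_integral do rewrite EFinD.
have Ege0 c (u : R) : (0 <= (f c u)%:E)%E by rewrite lee_fin.
(* The reflection [t |-> 1 - t] moves the singularity from 1 to 0. *)
have fa : (\int[leb]_t (f b (1 - t))%:E < +oo)%E.
  have N1 : (-1 : R) != 0 by rewrite oppr_eq0 oner_eq0.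
  have mfb : measurable_fun setT (fun t => (f b t)%:E) by exact/measurable_EFinP.
  have := @ge0_integral_affine R (-1) 1 (fun t => (f b t)%:E) N1 mfb (Ege0 b).
  rewrite normrN1 mul1e; under eq_integral do rewrite mulN1r addrC.
  by move=> ->; exact: intf.
have mZ c (h : R -> R) : measurable_fun setT h ->
    measurable_fun setT (fun t => (c * h t)%:E).
  by move=> mh; apply/measurable_EFinP; apply: measurable_funM.
rewrite ge0_integralD//; last 4 first.
- by move=> t _; rewrite lee_fin; apply: mulr_ge0; [exact: powR_ge0|exact: f0].
- exact: (mZ _ _ (mf a)).
- by move=> t _; rewrite lee_fin; apply: mulr_ge0; [exact: powR_ge0|exact: f0].
- exact: (mZ _ _ mf1).
rewrite !ge0_integral_EFinZl ?powR_ge0//; last exact: mf.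
have fin c (x : R) y : (y < +oo)%E -> ((x `^ c)%:E * y < +oo)%E.
  by move=> yoo; apply: lte_mul_pinfty => //; rewrite lee_fin powR_ge0.
by apply: lte_add_pinfty; [exact: fin (intf _ a1)|exact: fin fa].
Qed.

End beta_integral.

(** * The kernel: measurability, homogeneity, integrability *)

Section kernel.
Context (R : realType) (m : nat) (alpha : R).
Local Notation TR := (measurableTypeR R).
Local Notation leb := (@lebesgue_measure R).

(** Extension by zero off the cube turns an integral whose domain depends on [x] into one over all
    tuples, to which Tonelli and dilations apply directly. *)
Definition cube_kernel (x : R) (t : m.-tuple TR) : R :=
  \1_(@cube R m x) t * RL_kernel alpha x t.

Lemma RL_kernelE x (t : m.-tuple R) :
  RL_kernel alpha x t = (\sum_(i < m) (x - tnth t i) ^+ 2) `^ (- ((m%:R - alpha) / 2)).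
Proof.
rewrite /RL_kernel /enorm -powR12_sqrt; last by apply: sumr_ge0 => i _; exact: sqr_ge0.
by rewrite -powRN -powRrM; congr (_ `^ _); ring.
Qed.

Lemma RL_kernel_ge0 x (t : m.-tuple R) : 0 <= RL_kernel alpha x t.
Proof. by rewrite RL_kernelE powR_ge0. Qed.

Lemma cube_kernel_ge0 x t : 0 <= cube_kernel x t.
Proof. by rewrite mulr_ge0 ?RL_kernel_ge0. Qed.

Lemma measurable_cube x : measurable (@cube R m x).
Proof.
apply: (measurable_box (A := fun=> `]0, x[%classic)) => i.
exact: measurable_itv.
Qed.

(** The cube moves with [x], so Tonelli in [(x, t)] calls for joint measurability. *)
Lemma measurable_cube_graph :
  measurable [set p : TR * m.-tuple TR | cube p.1 p.2].
Proof.
rewrite (_ : [set _ | _] = \bigcap_(i in [set: 'I_m])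
  [set p : TR * m.-tuple TR | 0 < tnth p.2 i < p.1]); last first.
  by apply/seteqP; split=> p /= h i; [move=> _|]; exact: h.
apply: fin_bigcap_measurable => // i _.
have mt : measurable_fun setT (fun p : TR * m.-tuple TR => tnth p.2 i : R).
  by apply: measurableT_comp (measurable_tnth _) _; exact: measurable_snd.
have m1 := measurable_fun_ltr (measurable_cst (0 : R)) mt.
have m2 := measurable_fun_ltr mt (@measurable_fst _ _ TR (m.-tuple TR)).
have := measurable_and m1 m2.
by move=> /(_ measurableT [set true]); rewrite setTI; apply.
Qed.

Lemma measurable_RL_kernel :
  measurable_fun setT (fun p : TR * m.-tuple TR => RL_kernel alpha p.1 p.2).
Proof.
under eq_fun do rewrite RL_kernelE.
apply: (measurableT_comp (measurable_powR _)).
apply: measurable_sum => i; apply: measurable_funX; apply: measurable_funB.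
  exact: measurable_fst.
by apply: measurableT_comp (measurable_tnth _) _; exact: measurable_snd.
Qed.

Lemma measurable_cube_kernel2 :
  measurable_fun setT (fun p : TR * m.-tuple TR => cube_kernel p.1 p.2).
Proof.
apply: measurable_funM; last exact: measurable_RL_kernel.
rewrite (_ : (fun _ => _) = \1_[set p : TR * m.-tuple TR | cube p.1 p.2]).
  exact: measurable_indic measurable_cube_graph.
by apply/funext => p; rewrite !indicE; congr (_ _)%:R; apply/idP/idP; rewrite !inE.
Qed.

Lemma measurable_cube_kernel x : measurable_fun setT (cube_kernel x).
Proof. exact: (measurableT_comp measurable_cube_kernel2 (measurable_pair1 _)). Qed.

(** The cube of side [x] is [x] times the unit cube, and the Euclidean norm is homogeneous of degree
    1. *)
Lemma cube_kernel_scale x (s : m.-tuple TR) : 0 < x ->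
  cube_kernel x (tuple_scale x s) = x `^ (alpha - m%:R) * cube_kernel 1 s.
Proof.
move=> x0; rewrite /cube_kernel mulrCA; congr (_ * _).
  rewrite !indicE; congr (nat_of_bool _)%:R; apply/idP/idP; rewrite !inE => + i.
    move=> /(_ i); rewrite tnth_mktuple pmulr_rgt0// gtr_pMr//.
  by move=> /(_ i); rewrite tnth_mktuple pmulr_rgt0// gtr_pMr//.
rewrite !RL_kernelE.
under eq_bigr do rewrite tnth_mktuple -{1}(mulr1 x) -mulrBr exprMn.
rewrite -mulr_sumr powRM ?sqr_ge0//; last by apply: sumr_ge0 => i _; exact: sqr_ge0.
rewrite -powR_mulrn ?(ltW x0)// -powRrM; congr (_ `^ _ * _).
by field.
Qed.

Lemma powRN_le (e y z : R) : 0 <= e -> 0 < y -> y <= z -> z `^ (- e) <= y `^ (- e).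
Proof.
move=> e0 y0 yz; have z0 := lt_le_trans y0 yz.
by rewrite !powRN lef_pV2 ?posrE ?powR_gt0// ge0_ler_powR// nnegrE ltW.
Qed.

Hypothesis halpha : 0 < alpha < m%:R.

(** The power of the sum of squares is split into [m] equal factors. The exponent is negative and
    the sum is at least each of its terms, so the [i]-th factor may keep the [i]-th square alone. *)
Lemma RL_kernel_le_prod (t : m.-tuple TR) : cube 1 t ->
  RL_kernel alpha 1 t <= \prod_(i < m) (1 - tnth t i) `^ (- ((m%:R - alpha) / m%:R)).
Proof.
move=> t1; have [a0 am] := andP halpha.
have m0 : 0 < m%:R :> R by exact: lt_trans am.
rewrite RL_kernelE; set S := \sum_(i < m) _.
rewrite (_ : S `^ _ = \prod_(i < m) S `^ (- ((m%:R - alpha) / 2 / m%:R))); last first.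
  rewrite prodr_const card_ord -powR_mulrn ?powR_ge0// -powRrM.
  by congr (_ `^ _); field; rewrite gt_eqF.
apply: ler_prod => i _; rewrite powR_ge0/=.
have /andP[ti0 ti1] := t1 i.
have u0 : 0 < 1 - tnth t i by rewrite subr_gt0.
rewrite [leRHS](_ : _ = ((1 - tnth t i) ^+ 2) `^ (- ((m%:R - alpha) / 2 / m%:R))).
  apply: powRN_le; last 2 first.
  - by rewrite exprn_gt0.
  - by rewrite /S (bigD1 i)//= lerDl sumr_ge0// => j _; exact: sqr_ge0.
  by rewrite !mulr_ge0// ?invr_ge0// ?subr_ge0// ltW.
rewrite -powR_mulrn ?(ltW u0)// -powRrM; congr (_ `^ _).
by field; rewrite gt_eqF.
Qed.

(** The product bound on the kernel separates the variables and leaves Beta integrals with exponents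
    [1/p_i] and [b = (m - alpha)/m]; [0 < alpha] is what makes [b < 1]. *)
Lemma integral_RL_weight_lty (ps : 'I_m -> R) : (forall i, 1 < ps i) ->
  (\int[lebesgue_tuple R m]_t
    ((\prod_(i < m) tnth t i `^ (- (ps i)^-1)) * cube_kernel 1 t)%:E < +oo)%E.
Proof.
move=> hps; have [a0 am] := andP halpha.
have m0 : 0 < m%:R :> R by exact: lt_trans am.
set b := (m%:R - alpha) / m%:R.
have b01 : 0 <= b < 1.
  by rewrite divr_ge0 ?subr_ge0 ?(ltW am) ?(ltW m0)//= ltr_pdivrMr// mul1r gtrBl.
pose g i t := \1_(`]0%R, 1%R[%classic : set R) t *
  (t `^ (- (ps i)^-1) * (1 - t) `^ (- b)).
have g0 i t : 0 <= g i t by rewrite !mulr_ge0// powR_ge0.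
have mg i : measurable_fun setT (g i).
  apply: measurable_funM; first by apply: measurable_indic; exact: measurable_itv.
  apply: measurable_funM; first exact: measurable_powR.
  by apply: (measurableT_comp (measurable_powR _)); exact: measurable_funB.
apply: (@le_lt_trans _ _ (\int[lebesgue_tuple R m]_t
    (\prod_(i < m) g i (tnth t i))%:E)%E).
  apply: ge0_le_integral => //.
  - move=> t _; rewrite lee_fin mulr_ge0 ?cube_kernel_ge0//.
    by apply: prodr_ge0 => i _; exact: powR_ge0.
  - apply/measurable_EFinP; apply: measurable_funM; last exact: measurable_cube_kernel.
    apply: measurable_prod => i _.
    by apply: (measurableT_comp (measurable_powR _)); exact: measurable_tnth.
  - apply/measurable_EFinP; apply: measurable_prod => i _.
    by apply: (measurableT_comp (mg i)); exact: measurable_tnth.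
  - move=> t _; rewrite lee_fin /cube_kernel indicE.
    case: (boolP (t \in _)) => [|_]; last by rewrite mul0r mulr0 prodr_ge0.
    rewrite inE mul1r => t1; rewrite /g.
    apply: (le_trans (ler_wpM2l _ (RL_kernel_le_prod t1))).
      by apply: prodr_ge0 => i _; exact: powR_ge0.
    rewrite -big_split /=; apply: ler_prod => i _.
    rewrite mulr_ge0 ?powR_ge0//= indicE mem_set ?mul1r//=.
    by rewrite in_itv/=; exact: t1.
rewrite ge0_integral_lebesgue_tuple_prod//.
suff : (\prod_(i < m) \int[leb]_x (g i x)%:E)%E \is a fin_num by rewrite ltey_eq => ->.
elim/big_ind: _ => [//|x y|i _]; first exact: fin_numM.
rewrite ge0_fin_numE; last by apply: integral_ge0 => t _; rewrite lee_fin.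
apply: integral_beta_lty => //.
by rewrite invr_ge0 (ltW (lt_trans ltr01 (hps i)))//= invf_lt1// (lt_trans ltr01).
Qed.

End kernel.
(* Convexity of [expR] at [1], through [1 + x <= expR x], after dividing by the mean. *)
Lemma powR_prod_le_mean (R : realType) (I : finType) (w a : I -> R) :
  (forall i, 0 <= w i) -> (forall i, 0 <= a i) -> \sum_i w i = 1 ->
  \prod_i a i `^ w i <= \sum_i w i * a i.
Proof.
move=> w0 a0 w1; apply/ler_addgt0Pr => e e0.
(* The slack [e] makes [M] positive even if the mean is 0, so that [M] can be divided by and has a
   logarithm. *)
set M := \sum_i w i * a i + e.
have M0 : 0 < M by rewrite ltr_wpDl// sumr_ge0// => i _; rewrite mulr_ge0.
have aM i : a i `^ w i <= expR ((ln M + (a i / M - 1)) * w i).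
  rewrite expRM ge0_ler_powR ?nnegrE ?expR_ge0// expRD lnK ?posrE//.
  rewrite -[leLHS](@divfK _ M) ?gt_eqF// mulrC ler_wpM2l ?(ltW M0)//.
  by rewrite (le_trans _ (expR_ge1Dx _))// addrC subrK.
apply: (@le_trans _ _ (\prod_i expR ((ln M + (a i / M - 1)) * w i))).
  by apply: ler_prod => i _; rewrite powR_ge0/=.
rewrite -expR_sum -[leRHS](lnK M0) ler_expR.
rewrite (eq_bigr (fun i => (ln M - 1) * w i + M^-1 * (w i * a i))); last first.
  by move=> i _; ring.
rewrite big_split/= -!mulr_sumr w1 mulr1 -lerBrDl.
rewrite (_ : ln M - (ln M - 1) = M^-1 * M); last by rewrite mulVf ?gt_eqF//; ring.
by rewrite ler_wpM2l ?invr_ge0 ?(ltW M0)// lerDl ltW.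
Qed.

(** * The operator on nonnegative functions *)

Section real_operator.
Context (R : realType) (m : nat) (alpha : R).
Local Notation TR := (measurableTypeR R).
Local Notation leb := (@lebesgue_measure R).
Local Notation lebm := (lebesgue_tuple R m).

(** Values in [\bar R] let Tonelli run before convergence is known; the factor [1 / Gamma alpha] is
    left out. *)
Definition real_RL (g : 'I_m -> R -> R) (x : R) : \bar R :=
  (\int[lebm]_t ((\prod_(i < m) g i (tnth t i)) * cube_kernel alpha x t)%:E)%E.

Lemma measurable_tnth_comp (g : R -> R) (i : 'I_m) : measurable_fun setT g ->
  measurable_fun setT (fun p : TR * m.-tuple TR => g (tnth p.2 i)).
Proof.
move=> mg; apply: (measurableT_comp mg).
by apply: measurableT_comp (measurable_tnth _) _; exact: measurable_snd.
Qed.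

Variable g : 'I_m -> R -> R.
Hypotheses (mg : forall i, measurable_fun setT (g i)) (g0 : forall i t, 0 <= g i t).

Lemma real_RL_ge0 x : (0 <= real_RL g x)%E.
Proof.
apply: integral_ge0 => t _; rewrite lee_fin mulr_ge0 ?cube_kernel_ge0//.
exact: prodr_ge0.
Qed.

Lemma measurable_real_RL : measurable_fun setT (real_RL g).
Proof.
apply: (@measurable_fun_fubini_tonelli_F _ _ _ _ _ lebm
  (fun p : TR * m.-tuple TR =>
    ((\prod_(i < m) g i (tnth p.2 i)) * cube_kernel alpha p.1 p.2)%:E)).
  apply/measurable_EFinP; apply: measurable_funM.
    by apply: measurable_prod => i _; exact: measurable_tnth_comp.
  exact: measurable_cube_kernel2.
move=> p; rewrite lee_fin mulr_ge0 ?cube_kernel_ge0//.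
exact: prodr_ge0.
Qed.

(** The substitution [t = x s] has Jacobian [x^m], and the kernel contributes [x^(alpha - m)]. *)
Lemma real_RL_scale x : 0 < x -> real_RL g x =
  ((x `^ alpha)%:E *
   \int[lebm]_s ((\prod_(i < m) g i (x * tnth s i)%R) * cube_kernel alpha 1 s)%:E)%E.
Proof.
move=> x0; rewrite /real_RL -(@ge0_integral_tuple_scale R m x _ x0); last 2 first.
- apply/measurable_EFinP; apply: measurable_funM; last exact: measurable_cube_kernel.
  apply: measurable_prod => i _.
  by apply: (measurableT_comp (mg i)); exact: measurable_tnth.
- move=> t; rewrite lee_fin mulr_ge0 ?cube_kernel_ge0//.
  exact: prodr_ge0.
under eq_integral.
  move=> s _; rewrite cube_kernel_scale//.
  under eq_bigr do rewrite tnth_mktuple.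
  rewrite mulrCA; over.
rewrite ge0_integral_EFinZl ?powR_ge0//; last 2 first.
- apply: measurable_funM; last exact: measurable_cube_kernel.
  apply: measurable_prod => i _; apply: (measurableT_comp (mg i)).
  by apply: measurable_funM => //; exact: measurable_tnth.
- move=> t; rewrite mulr_ge0 ?cube_kernel_ge0//.
  exact: prodr_ge0.
rewrite muleA -EFinM -powR_mulrn ?(ltW x0)// -powRD; first by rewrite addrC subrK.
by rewrite (gt_eqF x0) implybT.
Qed.

End real_operator.
Lemma powR_prod (R : realType) (I : finType) (b : I -> R) (r : R) :
  (forall i, 0 <= b i) -> (\prod_i b i) `^ r = \prod_i b i `^ r.
Proof.
move=> b0; suff [] : (\prod_i b i) `^ r = \prod_i b i `^ r /\ 0 <= \prod_i b i by [].
apply: (big_ind2 (fun x y => x `^ r = y /\ 0 <= x)) => [|x1 x2 y1 y2 [<- x0] [<- y0]|i _].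
- by rewrite powR1.
- by rewrite powRM// mulr_ge0.
- by [].
Qed.

(** * The upper bound for nonnegative functions *)

Section upper_bound.
Context (R : realType) (m : nat) (alpha p : R) (ps : 'I_m -> R).
Local Notation TR := (measurableTypeR R).
Local Notation leb := (@lebesgue_measure R).
Local Notation lebm := (lebesgue_tuple R m).

(** The [W] of the overview, extended by zero off the unit cube. *)
Definition RL_weight (t : m.-tuple TR) : R :=
  (\prod_(i < m) tnth t i `^ (- (ps i)^-1)) * cube_kernel alpha 1 t.

Lemma RL_weight_ge0 t : 0 <= RL_weight t.
Proof.
rewrite mulr_ge0 ?cube_kernel_ge0//.
by apply: prodr_ge0 => i _; exact: powR_ge0.
Qed.

Lemma measurable_RL_weight : measurable_fun setT RL_weight.
Proof.
apply: measurable_funM; last exact: measurable_cube_kernel.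
apply: measurable_prod => i _.
by apply: (measurableT_comp (measurable_powR _)); exact: measurable_tnth.
Qed.

Lemma RL_weight_notin t : t \notin @cube R m 1 -> RL_weight t = 0.
Proof. by move=> /negbTE tc; rewrite /RL_weight /cube_kernel indicE tc mul0r mulr0. Qed.

Variables (g : 'I_m -> R -> R) (N : 'I_m -> R) (A : R).
Hypotheses (hp : 1 < p) (hps : forall i, 1 < ps i)
  (hpps : p^-1 = \sum_(i < m) (ps i)^-1)
  (mg : forall i, measurable_fun setT (g i)) (g0 : forall i t, 0 <= g i t)
  (N0 : forall i, 0 < N i)
  (gN : forall i, (\int[leb]_t (g i t `^ ps i)%:E <= (N i `^ ps i)%:E)%E)
  (intW : (\int[lebm]_t (RL_weight t)%:E = A%:E)%E).

Let p0 : 0 < p := lt_trans ltr01 hp.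
Let ps0 i : 0 < ps i := lt_trans ltr01 (hps i).

(** The [p_i]-th power of [g i], normalised by [N i] and dilated so that, for [s] in the unit cube,
    its integral in [x] is at most 1. The absolute value keeps it nonnegative off the cube. *)
Let a (x : R) (s : m.-tuple TR) i : R :=
  `|tnth s i| * (g i (tnth s i * x) `^ ps i / N i `^ ps i).

(** The AM-GM majorant of the Jensen integrand, up to the factor [(\prod_i N i)^p]. *)
Let H (x : R) (s : m.-tuple TR) : R :=
  (\sum_(i < m) (p / ps i) * a x s i) * RL_weight s.

Let a0 x s i : 0 <= a x s i.
Proof. by rewrite !mulr_ge0// ?invr_ge0 powR_ge0. Qed.

Let lam0 i : 0 <= p / ps i.
Proof. by rewrite divr_ge0 ?ltW. Qed.

Let lam1 : \sum_(i < m) p / ps i = 1.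
Proof. by rewrite -mulr_sumr -hpps mulfV ?gt_eqF. Qed.

Let H0 x s : 0 <= H x s.
Proof.
rewrite mulr_ge0 ?RL_weight_ge0//.
by apply: sumr_ge0 => i _; rewrite mulr_ge0.
Qed.

Let measurable_H : measurable_fun setT (fun q : TR * m.-tuple TR => H q.1 q.2).
Proof.
have mt i : measurable_fun setT (fun q : TR * m.-tuple TR => tnth q.2 i : R).
  by apply: measurableT_comp (measurable_tnth _) _; exact: measurable_snd.
apply: measurable_funM; last first.
  exact: (measurableT_comp measurable_RL_weight measurable_snd).
apply: measurable_sum => i; apply: measurable_funM => //; apply: measurable_funM.
  by apply: measurableT_comp; [exact: normr_measurable|exact: mt].
apply: measurable_funM => //; apply: (measurableT_comp (measurable_powR _)).
apply: (measurableT_comp (mg i)); apply: measurable_funM => //; exact: measurable_fst.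
Qed.

(** Scaling cancels [x^(-p alpha)], Jensen moves the power [p] inside the integral, and AM-GM with
    weights [p / ps i] replaces the product by the mean in [H]. *)
Let real_RL_powR_le x : 0 < x ->
  (real_RL alpha g x `^ p * (x `^ (- (p * alpha)))%:E <=
   (A `^ (p - 1) * (\prod_i N i) `^ p)%:E * \int[lebm]_s (H x s)%:E)%E.
Proof.
move=> x0; rewrite real_RL_scale//.
(* The factors [s_i^(1/p_i)] undo those in the weight: on the cube, [F] times the weight is the
   original integrand. *)
pose F (s : m.-tuple TR) : R :=
  \prod_(i < m) (tnth s i `^ (ps i)^-1 * g i (x * tnth s i)).
have F0 s : 0 <= F s by apply: prodr_ge0 => i _; rewrite mulr_ge0 ?powR_ge0.
have mF : measurable_fun setT F.
  apply: measurable_prod => i _; apply: measurable_funM.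
    by apply: (measurableT_comp (measurable_powR _)); exact: measurable_tnth.
  apply: (measurableT_comp (mg i)).
  by apply: measurable_funM => //; exact: measurable_tnth.
rewrite poweRM ?lee_fin ?powR_ge0//; last first.
  apply: integral_ge0 => s _; rewrite lee_fin mulr_ge0 ?cube_kernel_ge0//.
  exact: prodr_ge0.
rewrite muleAC poweR_EFin -EFinM -powRrM (mulrC alpha).
rewrite powRN mulfV ?gt_eqF ?powR_gt0// mul1e.
rewrite (eq_integral (fun s => (F s * RL_weight s)%:E)); last first.
  move=> s _; congr EFin; have [sc|sc] := boolP (s \in @cube R m 1); last first.
    by rewrite RL_weight_notin// /cube_kernel indicE (negbTE sc) mul0r !mulr0.
  rewrite /RL_weight mulrA; congr (_ * _); rewrite -big_split/=; apply: eq_bigr => i _.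
  move: sc; rewrite inE => /(_ i) /andP[si0 _].
  by rewrite mulrAC powRN mulfV ?mul1r// gt_eqF ?powR_gt0.
apply: (le_trans (hoelder_weight hp mF measurable_RL_weight F0 RL_weight_ge0 intW)).
rewrite EFinM -muleA; apply: lee_wpmul2l; first by rewrite lee_fin powR_ge0.
rewrite -ge0_integral_EFinZl ?powR_ge0//; last first.
  exact: (measurableT_comp measurable_H (measurable_pair1 x)).
have mFW : measurable_fun setT (fun s => F s `^ p * RL_weight s).
  apply: measurable_funM; last exact: measurable_RL_weight.
  exact: (measurableT_comp (measurable_powR _) mF).
apply: ge0_le_integral => //.
- by move=> s _; rewrite lee_fin mulr_ge0 ?powR_ge0 ?RL_weight_ge0.
- exact/measurable_EFinP.
- apply/measurable_EFinP; apply: measurable_funM => //.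
  exact: (measurableT_comp measurable_H (measurable_pair1 x)).
move=> s _; rewrite lee_fin /H mulrA.
have [sc|sc] := boolP (s \in @cube R m 1); last by rewrite RL_weight_notin// !mulr0.
apply: ler_wpM2r; first exact: RL_weight_ge0.
(* In this form [F^p] is [(\prod_i N i)^p] times a weighted geometric mean of the [a x s i]. *)
have Fa : F s = \prod_i N i * \prod_i a x s i `^ (ps i)^-1.
  rewrite -big_split/=; apply: eq_bigr => i _.
  move: sc; rewrite inE => /(_ i) /andP[si0 _].
  rewrite /a gtr0_norm// powRM ?(ltW si0) ?divr_ge0 ?powR_ge0//.
  rewrite powRM ?invr_ge0 ?powR_ge0// -powRrM mulfV ?gt_eqF// powRr1//.
  rewrite -powRN -powRrM mulNr mulfV ?gt_eqF// powR_inv1 ?(ltW (N0 i))//.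
  by rewrite (mulrC x); field; rewrite gt_eqF.
have aN i : 0 <= a x s i `^ (ps i)^-1 by exact: powR_ge0.
rewrite Fa powRM; [|by apply: prodr_ge0 => i _; exact: ltW|exact: prodr_ge0].
apply: ler_wpM2l; first exact: powR_ge0.
rewrite powR_prod//; under eq_bigr do rewrite -powRrM mulrC.
exact: powR_prod_le_mean.
Qed.

(** Tonelli brings the [x]-integral inside. There each [a x s i] integrates to at most 1 and the
    coefficients [p / ps i] sum to 1, so only the integral of the weight remains. *)
Let integral_H_le : (\int[leb]_x \int[lebm]_s (H x s)%:E <= A%:E)%E.
Proof.
have mH2 : measurable_fun setT (fun q : TR * m.-tuple TR => (H q.1 q.2)%:E).
  by apply/measurable_EFinP; exact: measurable_H.
rewrite (@fubini_tonelli _ _ _ _ R leb lebm (fun q => (H q.1 q.2)%:E))//=; last first.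
  by move=> q; rewrite lee_fin.
rewrite -intW; apply: ge0_le_integral => //.
- by move=> s _; apply: integral_ge0 => x _; rewrite lee_fin.
- apply: (@measurable_fun_fubini_tonelli_G _ _ _ _ R leb
    (fun q : TR * m.-tuple TR => (H q.1 q.2)%:E)) => //.
  by move=> q; rewrite lee_fin.
- by apply/measurable_EFinP; exact: measurable_RL_weight.
(* Off the cube [H] vanishes; inside it [s_i > 0] permits the dilation. *)
move=> s _; have [sc|sc] := boolP (s \in @cube R m 1); last first.
  rewrite /H RL_weight_notin//; under eq_integral do rewrite mulr0.
  by rewrite integral0.
have mb i : measurable_fun setT (fun x : R => g i (tnth s i * x) `^ ps i / N i `^ ps i).
  apply: measurable_funM => //.
  apply: (measurableT_comp (measurable_powR _)); apply: (measurableT_comp (mg i)).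
  exact: measurable_funM.
have ma i : measurable_fun setT (fun x : R => a x s i) by exact: measurable_funM.
have mla i : measurable_fun setT (fun x : R => p / ps i * a x s i)
  by exact: measurable_funM.
under eq_integral do rewrite /H mulrC.
rewrite ge0_integral_EFinZl ?RL_weight_ge0//; last 2 first.
- exact: measurable_sum.
- by move=> x; apply: sumr_ge0 => i _; rewrite mulr_ge0.
rewrite -[leRHS]mule1; apply: lee_wpmul2l; first by rewrite lee_fin RL_weight_ge0.
under eq_integral do rewrite -sumEFin.
rewrite ge0_integral_sum//; last 2 first.
- by move=> i; apply/measurable_EFinP; exact: mla.
- by move=> i x _; rewrite lee_fin mulr_ge0.
rewrite -lam1 -sumEFin; apply: lee_sum => i _.
rewrite ge0_integral_EFinZl//; last exact: ma.
rewrite -[leRHS]mule1; apply: lee_wpmul2l; first by rewrite lee_fin.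
move: sc; rewrite inE => /(_ i) /andP[si0 _].
have mgp : measurable_fun setT (fun t : R => g i t `^ ps i / N i `^ ps i).
  by apply: measurable_funM => //; apply: (measurableT_comp (measurable_powR _)).
rewrite /a ge0_integral_EFinZl//; last 2 first.
- exact: mb.
- by move=> x; rewrite mulr_ge0 ?invr_ge0 ?powR_ge0.
have mgpE : measurable_fun setT (fun t : R => (g i t `^ ps i / N i `^ ps i)%:E).
  exact/measurable_EFinP.
have gp0 t : (0 <= (g i t `^ ps i / N i `^ ps i)%:E)%E.
  by rewrite lee_fin mulr_ge0 ?invr_ge0 ?powR_ge0.
have aff := @ge0_integral_affine R (tnth s i) 0 _ (lt0r_neq0 si0) mgpE gp0.
rewrite [leLHS](_ : _ = \int[leb]_t (g i t `^ ps i / N i `^ ps i)%:E)%E; last first.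
  rewrite -aff (gtr0_norm si0); apply: (congr1 (fun z => (tnth s i)%:E * z)%E).
  by apply: eq_integral => x _; rewrite addr0.
under eq_integral do rewrite mulrC.
rewrite ge0_integral_EFinZl ?invr_ge0 ?powR_ge0//; last 2 first.
- exact: (measurableT_comp (measurable_powR _) (mg i)).
- by move=> x; exact: powR_ge0.
apply: (le_trans (lee_wpmul2l _ (gN i))); first by rewrite lee_fin invr_ge0 powR_ge0.
by rewrite -EFinM mulVf// gt_eqF ?powR_gt0.
Qed.

Lemma real_RL_bound :
  (\int[leb]_(x in `]0%R, +oo[)
     (real_RL alpha g x `^ p * (x `^ (- (p * alpha)))%:E) <=
   ((A * \prod_i N i) `^ p)%:E)%E.
Proof.
have A0 : 0 <= A.
  by rewrite -lee_fin -intW; apply: integral_ge0 => s _; rewrite lee_fin RL_weight_ge0.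
have mHx : measurable_fun setT (fun x : TR => \int[lebm]_s (H x s)%:E)%E.
  apply: (@measurable_fun_fubini_tonelli_F _ _ _ _ R lebm
    (fun q : TR * m.-tuple TR => (H q.1 q.2)%:E)).
    by apply/measurable_EFinP; exact: measurable_H.
  by move=> q; rewrite lee_fin.
have Hx0 x : (0 <= \int[lebm]_s (H x s)%:E)%E.
  by apply: integral_ge0 => s _; rewrite lee_fin.
set c := A `^ (p - 1) * (\prod_i N i) `^ p.
have c0 : 0 <= c by rewrite mulr_ge0 ?powR_ge0.
apply: (@le_trans _ _ (\int[leb]_(x in `]0%R, +oo[) (c%:E * \int[lebm]_s (H x s)%:E))%E).
  apply: ge0_le_integral => //.
  - by move=> x _; rewrite mule_ge0 ?poweR_ge0// lee_fin powR_ge0.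
  - apply: measurable_funTS; apply: emeasurable_funM.
      apply: (measurableT_comp (measurable_poweR _)); exact: measurable_real_RL.
    by apply/measurable_EFinP; exact: measurable_powR.
  - by apply: measurable_funTS; apply: emeasurable_funM.
  - by move=> x; rewrite /= in_itv/= andbT => x0; exact: real_RL_powR_le.
rewrite ge0_integralZl_EFin//; last exact: measurable_funTS.
apply: (@le_trans _ _ (c%:E * A%:E)%E).
  apply: lee_wpmul2l; first by rewrite lee_fin.
  (* The half-line is enlarged to the whole line, where the bound on [H] is available. *)
  apply: le_trans integral_H_le; exact: ge0_subset_integral.
rewrite -EFinM lee_fin /c powRM//; last by apply: prodr_ge0 => i _; exact: ltW.
by rewrite (mulrAC _ _ A) (mulrC (A `^ _) A) mulr_powRB1.
Qed.

End upper_bound.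

(** * Modulus, measurability and integrals of complex functions *)

Section complex_lemmas.
Context (R : realType).
Local Notation C := (R[i]).

Lemma cabs_ge0 (z : C) : 0 <= cabs z.
Proof. by case: z => a b; exact: sqrtr_ge0. Qed.

Lemma cabsM : {morph @cabs R : x y / x * y}.
Proof. exact: ComplexField.Normc.normcM. Qed.

Lemma cabs_real (x : R) : cabs x%:C = `|x|.
Proof. by rewrite /cabs /= expr0n addr0 sqrtr_sqr. Qed.

Lemma cabs_prod (I : Type) (s : seq I) (F : I -> C) :
  cabs (\prod_(i <- s) F i) = \prod_(i <- s) cabs (F i).
Proof.
apply: (big_morph _ cabsM).
by rewrite (_ : 1 = 1%:C)// cabs_real normr1.
Qed.

Lemma cabsE (z : C) : cabs z = Num.sqrt (complex.Re z ^+ 2 + complex.Im z ^+ 2).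
Proof. by case: z. Qed.

Lemma ReM_complex (x y : C) :
  complex.Re (x * y) = complex.Re x * complex.Re y - complex.Im x * complex.Im y.
Proof. by case: x => a b; case: y. Qed.

Lemma ImM_complex (x y : C) :
  complex.Im (x * y) = complex.Re x * complex.Im y + complex.Im x * complex.Re y.
Proof. by case: x => a b; case: y. Qed.

Lemma Re_le_cabs (z : C) : `|complex.Re z| <= cabs z.
Proof. by rewrite cabsE -sqrtr_sqr ler_wsqrtr// lerDl sqr_ge0. Qed.

Lemma Im_le_cabs (z : C) : `|complex.Im z| <= cabs z.
Proof. by rewrite cabsE -sqrtr_sqr ler_wsqrtr// lerDr sqr_ge0. Qed.

(** Cauchy-Schwarz in the plane by Lagrange's identity: the difference of the squares is
    [(a d - b c)^2]. *)
Lemma dot_le_cabs (a b : R) (z : C) :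
  a * complex.Re z + b * complex.Im z <= Num.sqrt (a ^+ 2 + b ^+ 2) * cabs z.
Proof.
rewrite cabsE; case: z => c d /=; rewrite -sqrtrM ?addr_ge0 ?sqr_ge0//.
apply: (le_trans (ler_norm _)); rewrite -sqrtr_sqr ler_wsqrtr// -subr_ge0.
by rewrite (_ : _ - _ = (a * d - b * c) ^+ 2) ?sqr_ge0//; ring.
Qed.

Context d (T : measurableType d).
Implicit Types (D : set T) (f : T -> C).

Lemma cmeasurableM D f g : cmeasurable D f -> cmeasurable D g ->
  cmeasurable D (fun x => f x * g x).
Proof.
move=> [f1 f2] [g1 g2]; split.
  under eq_fun do rewrite ReM_complex.
  by apply: measurable_funB; apply: measurable_funM.
under eq_fun do rewrite ImM_complex.
by apply: measurable_funD; apply: measurable_funM.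
Qed.

Lemma cmeasurable_prod D (I : Type) (s : seq I) (F : I -> T -> C) :
  (forall i, cmeasurable D (F i)) -> cmeasurable D (fun x => \prod_(i <- s) F i x).
Proof.
move=> mF; elim: s => [|i s ih].
  by under eq_fun do rewrite big_nil; split; exact: measurable_cst.
under eq_fun do rewrite big_cons.
exact: cmeasurableM.
Qed.

Lemma cmeasurable_real D (f : T -> R) : measurable_fun D f ->
  cmeasurable D (fun x => (f x)%:C).
Proof. by move=> mf; split => //; exact: measurable_cst. Qed.

Lemma measurable_cabs f : cmeasurable setT f -> measurable_fun setT (fun x => cabs (f x)).
Proof.
move=> [f1 f2]; under eq_fun do rewrite cabsE -powR12_sqrt ?addr_ge0 ?sqr_ge0//.
apply: (measurableT_comp (measurable_powR _)).
by apply: measurable_funD; exact: measurable_funX.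
Qed.

Context (mu : {measure set T -> \bar R}).

Lemma cintegrable_cabs D f : measurable D -> cmeasurable D f ->
  (\int[mu]_(x in D) (cabs (f x))%:E < +oo)%E -> measurable_fun D (fun x => cabs (f x)) ->
  cintegrable mu D f.
Proof.
move=> mD [f1 f2] foo mc; split; apply/integrableP; split.
- exact/measurable_EFinP.
- apply: le_lt_trans foo; apply: ge0_le_integral => //.
  + by do 2 apply: measurableT_comp => //; exact/measurable_EFinP.
  + exact/measurable_EFinP.
  + by move=> x _; rewrite lee_fin Re_le_cabs.
- exact/measurable_EFinP.
- apply: le_lt_trans foo; apply: ge0_le_integral => //.
  + by do 2 apply: measurableT_comp => //; exact/measurable_EFinP.
  + exact/measurable_EFinP.
  + by move=> x _; rewrite lee_fin Im_le_cabs.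
Qed.

(* The integral is rotated onto the positive real axis. *)
Lemma cabs_cintegral_le D f : measurable D -> cintegrable mu D f ->
  measurable_fun D (fun x => cabs (f x)) ->
  ((cabs (cintegral mu D f))%:E <= \int[mu]_(x in D) (cabs (f x))%:E)%E.
Proof.
move=> mD [i1 i2] mc.
set I := cintegral mu D f; set a := complex.Re I; set b := complex.Im I.
have [I0|I0] := eqVneq (cabs I) 0.
  by rewrite I0 integral_ge0// => x _; rewrite lee_fin cabs_ge0.
have Ipos : 0 < cabs I by rewrite lt_def I0 cabs_ge0.
have [foo|] := ltP (\int[mu]_(x in D) (cabs (f x))%:E)%E +oo%E; last first.
  by rewrite leye_eq => /eqP ->; rewrite leey.
have icf : mu.-integrable D (fun x => (cabs (f x))%:E).
  apply/integrableP; split; first exact/measurable_EFinP.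
  by under eq_integral do rewrite gee0_abs ?lee_fin ?cabs_ge0//.
have aE : a%:E = (\int[mu]_(x in D) (complex.Re (f x))%:E)%E.
  by rewrite /a/= fineK//; exact: integrable_fin_num.
have bE : b%:E = (\int[mu]_(x in D) (complex.Im (f x))%:E)%E.
  by rewrite /b/= fineK//; exact: integrable_fin_num.
(* The rotation is a pairing with [I]: [|I|^2] is the integral of the real part of [conj(I) f],
   which is at most [|I| |f|]. One factor [|I|] is then divided out. *)
have key : (((cabs I) ^+ 2)%:E <= (cabs I)%:E * \int[mu]_(x in D) (cabs (f x))%:E)%E.
  rewrite cabsE -/a -/b sqr_sqrtr ?addr_ge0 ?sqr_ge0// !expr2 EFinD !EFinM {2}aE {2}bE.
  rewrite -!integralZl//.
  have i1' := integrableZl mD a i1; have i2' := integrableZl mD b i2.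
  rewrite -integralD//; apply: le_integral => //.
  - exact: integrableD.
  - exact: integrableZl.
  - by move=> x _; rewrite -!EFinM -EFinD lee_fin dot_le_cabs.
move: key; rewrite expr2 EFinM lee_pmul2l//.
Qed.

End complex_lemmas.
(** Tonelli is applied to the positive and negative parts separately, so [h] may change sign. *)
Lemma measurable_fun_param_integral d1 d2 (T1 : measurableType d1)
    (T2 : measurableType d2) (R : realType)
    (mu : {sigma_finite_measure set T2 -> \bar R}) (h : T1 * T2 -> \bar R) :
  measurable_fun setT h ->
  measurable_fun setT (fun x => \int[mu]_t h (x, t))%E.
Proof.
move=> mh; under eq_fun do rewrite integralE.
under eq_fun do [under eq_integral do rewrite funeposE;
  under [X in (_ - X)%E]eq_integral do rewrite funenegE].
apply: emeasurable_funB.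
- have := @measurable_fun_fubini_tonelli_F _ _ _ _ _ mu (fun q => maxe (h q) 0%E).
  apply; last by move=> q; rewrite le_max lexx orbT.
  have := measurable_funepos mh; congr measurable_fun.
  by apply/funext => q; rewrite funeposE.
- have := @measurable_fun_fubini_tonelli_F _ _ _ _ _ mu (fun q => maxe (- h q) 0)%E.
  apply; last by move=> q; rewrite le_max lexx orbT.
  have := measurable_funeneg mh; congr measurable_fun.
  by apply/funext => q; rewrite funenegE.
Qed.

(** * Comparison of the complex operator with the nonnegative one *)

Section complex_operator.
Context (R : realType) (m : nat) (alpha : R) (f : 'I_m -> R -> R[i]).
Local Notation TR := (measurableTypeR R).
Local Notation leb := (@lebesgue_measure R).
Local Notation lebm := (lebesgue_tuple R m).
Hypothesis mf : forall i, @cmeasurable R _ TR setT (f i).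

Let g i t : R := cabs (f i t).

Let g0 i t : 0 <= g i t. Proof. exact: cabs_ge0. Qed.

Let mg i : measurable_fun setT (g i).
Proof. exact: (@measurable_cabs R _ TR). Qed.

Lemma cabs_RL_integrand x (t : m.-tuple TR) : cabs (RL_integrand alpha f x t) =
  (\prod_(i < m) cabs (f i (tnth t i))) * RL_kernel alpha x t.
Proof. by rewrite cabsM cabs_prod cabs_real ger0_norm ?RL_kernel_ge0. Qed.

Lemma cmeasurable_RL_integrand :
  cmeasurable setT (fun q : TR * m.-tuple TR => RL_integrand alpha f q.1 q.2).
Proof.
apply: cmeasurableM; last by apply: cmeasurable_real; exact: measurable_RL_kernel.
apply: cmeasurable_prod => i; have [f1 f2] := mf i.
by split; [exact: (measurable_tnth_comp i f1)|exact: (measurable_tnth_comp i f2)].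
Qed.

Lemma cmeasurable_RL_integrand1 x :
  cmeasurable setT (fun t : m.-tuple TR => RL_integrand alpha f x t).
Proof.
have [h1 h2] := cmeasurable_RL_integrand.
split; [exact: (measurableT_comp h1 (measurable_pair1 x))|].
exact: (measurableT_comp h2 (measurable_pair1 x)).
Qed.

Lemma integral_cabs_RL_integrand x :
  (\int[lebm]_(t in @cube R m x) (cabs (RL_integrand alpha f x t))%:E =
   real_RL alpha (fun i t => cabs (f i t)) x)%E.
Proof.
rewrite integral_mkcond; apply: eq_integral => t _.
rewrite patchE cabs_RL_integrand /cube_kernel indicE mulrCA.
by case: ifPn => _; rewrite ?mul1r ?mul0r.
Qed.

Lemma RL_cintegrable x : (real_RL alpha (fun i t => cabs (f i t)) x < +oo)%E ->
  cintegrable lebm (@cube R m x) (RL_integrand alpha f x).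
Proof.
rewrite -integral_cabs_RL_integrand => foo.
have [h1 h2] := cmeasurable_RL_integrand1 x.
apply: cintegrable_cabs => //; first exact: measurable_cube.
- by split; exact: measurable_funTS.
- apply: measurable_funTS; exact: measurable_cabs.
Qed.

Lemma Gamma_ge0 (b : R) : 0 <= Gamma b.
Proof.
apply: Rintegral_ge0 => t _; by rewrite mulr_ge0 ?powR_ge0 ?expR_ge0.
Qed.

Lemma cabs_RL x : cabs (RL alpha f x) =
  (Gamma alpha)^-1 * cabs (cintegral lebm (@cube R m x) (RL_integrand alpha f x)).
Proof. by rewrite /RL cabsM cabs_real ger0_norm// invr_ge0 Gamma_ge0. Qed.

Lemma cabs_RL_le x : ((cabs (RL alpha f x))%:E <=
  ((Gamma alpha)^-1)%:E * real_RL alpha (fun i t => cabs (f i t)) x)%E.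
Proof.
(* Here [alpha] is arbitrary and a divergent Gamma integral has the default value 0; its inverse is
   then 0 and both sides vanish. *)
have [Ga0|Ga0] := eqVneq (Gamma alpha) 0.
  by rewrite cabs_RL Ga0 invr0 mul0r mul0e.
have G0 : 0 < Gamma alpha by rewrite lt_def Ga0 Gamma_ge0.
rewrite cabs_RL EFinM; apply: lee_wpmul2l; first by rewrite lee_fin invr_ge0 ltW.
have [foo|] := ltP (real_RL alpha (fun i t => cabs (f i t)) x) +oo%E; last first.
  by rewrite leye_eq => /eqP ->; rewrite leey.
rewrite -integral_cabs_RL_integrand; apply: cabs_cintegral_le.
- exact: measurable_cube.
- exact: RL_cintegrable.
- by apply: measurable_funTS; apply: measurable_cabs; exact: cmeasurable_RL_integrand1.
Qed.

Lemma cmeasurable_RL D : @cmeasurable R _ TR D (RL alpha f).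
Proof.
have param (h : TR -> m.-tuple TR -> R) :
    measurable_fun setT (fun q : TR * m.-tuple TR => h q.1 q.2) ->
    measurable_fun setT (fun x : TR => \int[lebm]_(t in @cube R m x) h x t).
  move=> mh; rewrite /Rintegral.
  (* The indicator of the region turns the domain moving with [x] into a factor of a jointly
     measurable function. *)
  have mcube : measurable_fun setT (fun q : TR * m.-tuple TR =>
      (\1_[set p : TR * m.-tuple TR | cube p.1 p.2] q * h q.1 q.2)%:E).
    apply/measurable_EFinP; apply: measurable_funM => //.
    by apply: measurable_indic; exact: measurable_cube_graph.
  have := measurable_fun_param_integral lebm mcube.
  rewrite (_ : (fun x => _) = (fun x => \int[lebm]_(t in @cube R m x) (h x t)%:E)%E).
    by move=> mI; apply: (measurableT_comp _ mI); exact: fine_measurable.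
  apply/funext => x; rewrite [RHS]integral_mkcond; apply: eq_integral => t _.
  rewrite patchE indicE; case: ifPn.
    by rewrite inE => tc; rewrite mem_set ?mul1r.
  by move=> /negP tc; rewrite memNset ?mul0r// => tc'; apply: tc; rewrite inE.
have [h1 h2] := cmeasurable_RL_integrand.
have mI : @cmeasurable R _ TR D (fun x =>
    cintegral lebm (@cube R m x) (RL_integrand alpha f x)).
  by split; apply: measurable_funTS; exact: param.
by apply: cmeasurableM mI; apply: cmeasurable_real; exact: measurable_cst.
Qed.

End complex_operator.
(** Removes the slack from a bound proved with strictly positive majorants of the norms. The product
    is a polynomial in [e], so on [[0, 1]] it exceeds its value at 0 by at most a multiple of
    [e]. *)
Lemma le_prod_of_le_prodD (R : realType) (I : finType) (n : I -> R) (c v : R) :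
  0 <= c -> (forall i, 0 <= n i) ->
  (forall e, 0 < e -> v <= c * \prod_i (n i + e)) -> v <= c * \prod_i n i.
Proof.
move=> c0 n0 H.
have [B B0 HB] : exists2 B : R, 0 <= B & forall e, 0 <= e <= 1 ->
    \prod_i (n i + e) <= \prod_i n i + e * B.
  elim: (index_enum I) => [|i s [B B0 ih]].
    by exists 0 => // e _; rewrite !big_nil mulr0 addr0.
  set P := \prod_(j <- s) n j in ih *.
  have P0 : 0 <= P by exact: prodr_ge0.
  (* This constant comes from expanding [(n i + e) (P + e B)] and using [e^2 <= e]. *)
  exists (n i * B + P + B) => [|e /[dup] e01 /andP[e0 e1]].
    by rewrite !addr_ge0// mulr_ge0.
  rewrite !big_cons -/P; apply: (le_trans (ler_wpM2l _ (ih _ e01))).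
    by rewrite addr_ge0.
  rewrite -subr_ge0 (_ : _ - _ = e * B * (1 - e)); last by ring.
  by rewrite !mulr_ge0// subr_ge0.
apply/ler_addgt0Pr => d d0.
have B1 : 0 < c * B + 1 by rewrite ltr_wpDl// mulr_ge0.
(* The minimum keeps [e] in the range of [HB]; the added 1 keeps the denominator positive when
   [c * B = 0]. *)
pose e := Num.min 1 (d / (c * B + 1)).
have e0 : 0 < e by rewrite lt_min ltr01 divr_gt0.
have e1 : e <= 1 by rewrite ge_min lexx.
have ed : e * (c * B + 1) <= d by rewrite -ler_pdivlMr// ge_min lexx orbT.
apply: (le_trans (H e e0)).
apply: (le_trans (ler_wpM2l c0 (HB e _))); first by rewrite (ltW e0).
rewrite mulrDr lerD2l (le_trans _ ed)// mulrDr mulr1 ler_wpDr ?(ltW e0)//.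
by rewrite mulrCA.
Qed.

(** * The upper bound for complex functions *)

Section sharp_constant.
Context (R : realType) (m : nat) (alpha p : R) (ps : 'I_m -> R).
Local Notation TR := (measurableTypeR R).
Local Notation leb := (@lebesgue_measure R).
Local Notation lebm := (lebesgue_tuple R m).
Hypotheses (halpha : 0 < alpha < m%:R) (hp : 1 < p) (hps : forall i, 1 < ps i)
  (hpps : p^-1 = \sum_(i < m) (ps i)^-1).

Let p0 : 0 < p := lt_trans ltr01 hp.
Let ps0 i : 0 < ps i := lt_trans ltr01 (hps i).

Let A : R := fine (\int[lebm]_t (RL_weight alpha ps t)%:E)%E.

Lemma integral_RL_weightE : (\int[lebm]_t (RL_weight alpha ps t)%:E = A%:E)%E.
Proof.
rewrite /A fineK// ge0_fin_numE; first exact: integral_RL_weight_lty.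
by apply: integral_ge0 => t _; rewrite lee_fin RL_weight_ge0.
Qed.

Let intW := integral_RL_weightE.

Let A0 : 0 <= A.
Proof.
by rewrite -lee_fin -intW; apply: integral_ge0 => t _; rewrite lee_fin RL_weight_ge0.
Qed.

Lemma RL_constantE : RL_constant alpha ps = ((Gamma alpha)^-1 * A)%:E.
Proof.
rewrite EFinM -intW /RL_constant integral_mkcond; congr (_ * _)%E.
apply: eq_integral => t _; rewrite patchE /RL_weight /cube_kernel indicE.
by case: ifPn => _; rewrite ?mul1r// mul0r mulr0.
Qed.

Section upper.
Variable f : 'I_m -> R -> R[i].
Hypothesis hf : forall i, in_Lp (ps i) (f i).

Let g i t : R := cabs (f i t).
Let n i : R := fine (Lp_norm (ps i) (f i)).

Let Lp_normE i : Lp_norm (ps i) (f i) = (n i)%:E.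
Proof.
by have [_ ?] := hf i; rewrite /n fineK// ge0_fin_numE// Lnorm_ge0.
Qed.

Let n0 i : 0 <= n i.
Proof. by rewrite -lee_fin -Lp_normE Lnorm_ge0. Qed.

Let mg i : measurable_fun setT (g i).
Proof. by have [? _] := hf i; exact: (@measurable_cabs R _ TR). Qed.

(** Norms may vanish, so they are enlarged by [e] before serving as the positive normalisers
    [N i]. *)
Let real_bound e : 0 < e ->
  (\int[leb]_(x in `]0%R, +oo[)
     (real_RL alpha g x `^ p * (x `^ (- (p * alpha)))%:E) <=
   ((A * \prod_i (n i + e)) `^ p)%:E)%E.
Proof.
move=> e0; apply: (real_RL_bound hp hps hpps mg _ _ _ intW).
- by move=> i t; exact: cabs_ge0.
- by move=> i; rewrite ltr_wpDl.
move=> i; apply: (@le_trans _ _ (n i `^ ps i)%:E); last first.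
  have ne : n i <= n i + e by rewrite lerDl ltW.
  by rewrite lee_fin ge0_ler_powR ?nnegrE ?(ltW (ps0 i)) ?n0 ?(le_trans (n0 i) ne).
rewrite -poweR_EFin -Lp_normE poweR_Lnorm ?gt_eqF//.
apply: ge0_le_integral => //.
- by move=> t _; rewrite lee_fin powR_ge0.
- by apply/measurable_EFinP; exact: (measurableT_comp (measurable_powR _) (mg i)).
- apply: (measurableT_comp (measurable_poweR _)); apply: measurableT_comp => //.
  by apply/measurable_EFinP; exact: mg.
- by move=> t _; rewrite /= lee_fin ger0_norm ?cabs_ge0.
Qed.

Let S x : \bar R := (real_RL alpha g x `^ p * (x `^ (- (p * alpha)))%:E)%E.

Let S0 x : (0 <= S x)%E.
Proof. by rewrite mule_ge0 ?poweR_ge0// lee_fin powR_ge0. Qed.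

Let mS : measurable_fun setT S.
Proof.
apply: emeasurable_funM.
  apply: (measurableT_comp (measurable_poweR _)); apply: measurable_real_RL => //.
  by move=> i t; exact: cabs_ge0.
by apply/measurable_EFinP; exact: measurable_powR.
Qed.

Let mf i : @cmeasurable R _ TR setT (f i).
Proof. by have [] := hf i. Qed.

(** The bound with slack 1 gives [S] a finite integral, hence finite values almost everywhere. *)
Lemma ae_RL_cintegrable :
  {ae leb, forall x, 0 < x -> cintegrable lebm (@cube R m x) (RL_integrand alpha f x)}.
Proof.
have iS : leb.-integrable `]0%R, +oo[ S.
  apply/integrableP; split; first exact: measurable_funTS.
  under eq_integral do rewrite gee0_abs//.
  by apply: (le_lt_trans (real_bound ltr01)); exact: ltry.
have mD : measurable (`]0%R, +oo[%classic : set TR) by exact: measurable_itv.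
have := integrable_ae mD iS.
apply: filterS => x /= + x0; rewrite in_itv/= x0 => /(_ isT) Sfin.
apply: RL_cintegrable => //.
(* The power of [x] in [S] is positive, so an infinite [real_RL] would make [S] infinite. *)
rewrite ltey; apply/negP => /eqP Soo; move: Sfin.
by rewrite /S Soo poweRyr ?gt_eqF// gt0_mulye// lte_fin powR_gt0.
Qed.

(** The modulus is dominated pointwise by [real_RL], which reduces the claim to [real_bound]; then
    the slack tends to 0. *)
Lemma RL_upper_bound : (wLp_norm p alpha (RL alpha f) <=
  ((Gamma alpha)^-1 * A)%:E * \prod_(i < m) Lp_norm (ps i) (f i))%E.
Proof.
have c0 : 0 <= (Gamma alpha)^-1 by rewrite invr_ge0 Gamma_ge0.
have K0 : 0 <= (Gamma alpha)^-1 * A by rewrite mulr_ge0.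
have bnd e : 0 < e -> (wLp_norm p alpha (RL alpha f) <=
    ((Gamma alpha)^-1 * A * \prod_i (n i + e))%:E)%E.
  move=> e0.
  have P0 : 0 <= \prod_i (n i + e) by apply: prodr_ge0 => i _; rewrite addr_ge0// ltW.
  rewrite -[leRHS]poweRe1 ?lee_fin ?mulr_ge0//.
  (* Splitting the exponent 1 makes both sides powers of exponent [p^-1]. *)
  rewrite [X in (_ <= _ `^ X)%E](_ : _ = p * p^-1); last by rewrite mulfV ?gt_eqF.
  rewrite poweRrM /wLp_norm gt0_ler_poweR ?invr_ge0 ?(ltW p0)//.
  - by rewrite in_itv/= leey andbT; apply: integral_ge0 => x _;
      rewrite lee_fin mulr_ge0 ?powR_ge0.
  - by rewrite in_itv/= leey andbT lee_fin powR_ge0.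
  rewrite -mulrA poweR_EFin powRM ?mulr_ge0// EFinM.
  apply: (@le_trans _ _ (\int[leb]_(x in `]0%R, +oo[)
    (((Gamma alpha)^-1 `^ p)%:E * S x))%E); last first.
    rewrite ge0_integralZl_EFin ?powR_ge0//; last exact: measurable_funTS.
    apply: lee_wpmul2l; first by rewrite lee_fin powR_ge0.
    exact: real_bound.
  apply: ge0_le_integral => //.
  - by move=> x _; rewrite lee_fin mulr_ge0 ?powR_ge0.
  - apply/measurable_EFinP; apply: measurable_funM; last first.
      by apply: measurable_funTS; exact: measurable_powR.
    apply: measurable_funTS; apply: (measurableT_comp (measurable_powR _)).
    by apply: (@measurable_cabs R _ TR); exact: cmeasurable_RL.
  - by apply: measurable_funTS; exact: emeasurable_funM.
  move=> x _; rewrite EFinM /S muleA; apply: lee_wpmul2r.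
    by rewrite lee_fin powR_ge0.
  have RL0 : (0 <= real_RL alpha g x)%E by apply: real_RL_ge0 => i t; exact: cabs_ge0.
  rewrite -!poweR_EFin -poweRM ?lee_fin// gt0_ler_poweR ?(ltW p0)//.
  - by rewrite in_itv/= leey andbT lee_fin sqrtr_ge0.
  - by rewrite in_itv/= leey andbT mule_ge0.
  - exact: cabs_RL_le.
(* The bound with slack 1 makes the norm finite, so the limit can be taken in [R]. *)
have wfin : wLp_norm p alpha (RL alpha f) = (fine (wLp_norm p alpha (RL alpha f)))%:E.
  rewrite fineK// ge0_fin_numE ?poweR_ge0//.
  by apply: (le_lt_trans (bnd 1 ltr01)); exact: ltry.
rewrite wfin (eq_bigr (fun i => (n i)%:E)) => [|i _]; last exact: Lp_normE.
rewrite prodEFin -EFinM lee_fin; apply: le_prod_of_le_prodD => // e e0.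
by rewrite -lee_fin -wfin; exact: bnd.
Qed.

End upper.

End sharp_constant.
Lemma prodr_powR (R : realType) (I : finType) (x : R) (r : I -> R) : 0 < x ->
  \prod_i x `^ r i = x `^ (\sum_i r i).
Proof.
move=> x0; apply/esym; apply: (big_morph (fun y => x `^ y)) => [u v|].
  by rewrite powRD// (gt_eqF x0) implybT.
exact: powRr0.
Qed.

(** * The lower bound from truncated power functions *)

Section lower_bound.
Context (R : realType) (m : nat) (alpha p : R) (ps : 'I_m -> R).
Local Notation TR := (measurableTypeR R).
Local Notation leb := (@lebesgue_measure R).
Local Notation lebm := (lebesgue_tuple R m).
Hypotheses (halpha : 0 < alpha < m%:R) (hp : 1 < p) (hps : forall i, 1 < ps i)
  (hpps : p^-1 = \sum_(i < m) (ps i)^-1).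

Let p0 : 0 < p := lt_trans ltr01 hp.
Let ps0 i : 0 < ps i := lt_trans ltr01 (hps i).

Let W := RL_weight alpha ps.
Let W0 t : 0 <= W t. Proof. exact: RL_weight_ge0. Qed.
Let mW D : measurable_fun D (fun t => (W t)%:E).
Proof. by apply/measurable_EFinP/measurable_funTS; exact: measurable_RL_weight. Qed.

Let A : R := fine (\int[lebm]_t (W t)%:E)%E.
Let intW : (\int[lebm]_t (W t)%:E = A%:E)%E := integral_RL_weightE halpha hps.

Let E (l : R) : set (m.-tuple TR) := [set t | forall i, l^-1 <= tnth t i].

Let mE l : measurable (E l).
Proof.
rewrite (_ : E l = [set t | forall i, `[l^-1, +oo[%classic (tnth t i)]).
  by apply: (measurable_box (A := fun=> `[l^-1, +oo[%classic)) => i;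
    exact: measurable_itv.
by apply/seteqP; split=> t /= h i; have := h i; rewrite in_itv/= andbT.
Qed.

Section test_functions.
Variable e : R.
Hypothesis e0 : 0 < e.

(** Nearly extremal functions: [t^(-1/p_i)] just fails to lie in [L^(p_i)]. The cutoff removes the
    singularity at 0 and [e] restores convergence at infinity. *)
Definition power_tail i (t : R) : R :=
  \1_(`[1, +oo[%classic : set R) t * t `^ (- ((1 + e) / ps i)).

Let h := power_tail.

Let h0 i t : 0 <= h i t.
Proof. by rewrite mulr_ge0// powR_ge0. Qed.

Let mh i : measurable_fun setT (h i).
Proof.
apply: measurable_funM; last exact: measurable_powR.
by apply: measurable_indic; exact: measurable_itv.
Qed.

Let hE i t : 1 <= t -> h i t = t `^ (- ((1 + e) / ps i)).
Proof. by move=> t1; rewrite /h /power_tail indicE mem_set ?mul1r//= in_itv/= t1. Qed.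

Let h_lt1 i t : t < 1 -> h i t = 0.
Proof.
by move=> t1; rewrite /h /power_tail indicE memNset ?mul0r//= in_itv/= andbT leNgt t1.
Qed.

Lemma Lp_norm_power_tail i :
  Lp_norm (ps i) (fun t => (power_tail i t)%:C) = (e^-1 `^ (ps i)^-1)%:E.
Proof.
rewrite /Lp_norm unlock -poweR_EFin; congr (_ `^ _)%E.
transitivity (\int[leb]_(x in `[1%R, +oo[) (x `^ (- (1 + e)))%:E)%E; last first.
  by rewrite integral_powR_itvy// powR1 mulr1.
rewrite [RHS]integral_mkcond; apply: eq_integral => t _.
rewrite patchE /= expr0n/= addr0 sqrtr_sqr normr_id ger0_norm ?h0//.
have [t1|t1] := lerP 1 t.
  by rewrite mem_set/= ?in_itv/= ?t1// -/h hE// -powRrM mulNr divfK ?gt_eqF.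
rewrite memNset/= ?in_itv/= ?andbT ?leNgt ?t1//.
by rewrite -/h h_lt1 ?powR0 ?gt_eqF.
Qed.

Lemma in_Lp_power_tail i : in_Lp (ps i) (fun t => (power_tail i t)%:C).
Proof.
split; last by rewrite Lp_norm_power_tail ltry.
by apply: cmeasurable_real; exact: mh.
Qed.

Let S := real_RL alpha h.

Let S_scale x : 0 < x -> S x = ((x `^ alpha)%:E *
  \int[lebm]_s ((\prod_(i < m) h i (x * tnth s i)%R) * cube_kernel alpha 1 s)%:E)%E.
Proof. by move=> x0; rewrite /S real_RL_scale. Qed.

Let h_le1 i t : h i t <= 1.
Proof.
have [t1|/h_lt1 ->//] := lerP 1 t.
rewrite hE// powRN invf_le1 ?powR_gt0 ?(lt_le_trans ltr01)//.
rewrite -[leLHS](powRr0 t) ler_powR//.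
by rewrite divr_ge0 ?addr_ge0 ?ltW.
Qed.

Let mTs x : measurable_fun setT
  (fun s : m.-tuple TR =>
    ((\prod_(i < m) h i (x * tnth s i)%R) * cube_kernel alpha 1 s)%:E).
Proof.
apply/measurable_EFinP; apply: measurable_funM; last exact: measurable_cube_kernel.
apply: measurable_prod => i _; apply: (measurableT_comp (mh i)).
by apply: measurable_funM => //; exact: measurable_tnth.
Qed.

Let Ts0 x s : 0 <= (\prod_(i < m) h i (x * tnth s i)%R) * cube_kernel alpha 1 s.
Proof. by rewrite mulr_ge0 ?cube_kernel_ge0 ?prodr_ge0. Qed.

(** On the cube every [h] is at most 1, hence at most [s_i^(-1/p_i)], so [W] dominates the
    integrand. Finiteness ensures that [RL] does not take a default value. *)
Let S_lty x : 0 < x -> (S x < +oo)%E.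
Proof.
move=> x0; rewrite S_scale//; apply: lte_mul_pinfty; rewrite ?lee_fin ?powR_ge0//.
apply: (@le_lt_trans _ _ A%:E); last exact: ltry.
rewrite -intW; apply: ge0_le_integral => //; first by move=> s _; rewrite lee_fin.
move=> s _; rewrite lee_fin.
have [sc|sc] := boolP (s \in @cube R m 1); last first.
  by rewrite /cube_kernel indicE (negbTE sc) mul0r mulr0.
apply: ler_wpM2r; first exact: cube_kernel_ge0.
apply: ler_prod => i _; rewrite h0/= (le_trans (h_le1 _ _))//.
move: sc; rewrite inE => /(_ i) /andP[s0 s1].
rewrite powRN invf_ge1 ?powR_gt0// -[leRHS](powRr0 (tnth s i)) ger_powR ?s0 ?ltW//.
by rewrite invr_gt0.
Qed.

(** For [x >= l] and [s] in [E l] each [x s_i] is at least 1, so the cutoff is inactive and the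
    powers of [x] factor out; since [s_i < 1], dropping [e] from the exponent of [s_i] only
    decreases the integrand. *)
Let S_ge l x : 1 <= l -> l <= x ->
  ((x `^ (alpha - (1 + e) / p))%:E * \int[lebm]_(s in E l) (W s)%:E <= S x)%E.
Proof.
move=> l1 lx; have l0 := lt_le_trans ltr01 l1; have x0 := lt_le_trans l0 lx.
rewrite S_scale// powRD ?(gt_eqF x0) ?implybT// EFinM -muleA.
apply: lee_wpmul2l; first by rewrite lee_fin powR_ge0.
rewrite -ge0_integralZl_EFin ?powR_ge0//; last by move=> s _; rewrite lee_fin.
rewrite [leLHS]integral_mkcond; apply: ge0_le_integral => //.
- move=> s _; rewrite patchE; case: ifPn => // _.
  by rewrite mule_ge0// lee_fin ?powR_ge0.
- apply/(measurable_restrictT _ (mE l)).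
  apply: emeasurable_funM => //.
move=> s _; rewrite patchE; case: ifPn => [|_]; last by rewrite lee_fin.
rewrite inE => sE; rewrite -EFinM lee_fin.
have [sc|sc] := boolP (s \in @cube R m 1); last first.
  by rewrite /W RL_weight_notin// mulr0.
rewrite /W /RL_weight mulrA; apply: ler_wpM2r; first exact: cube_kernel_ge0.
rewrite (_ : - ((1 + e) / p) = \sum_(i < m) - ((1 + e) / ps i)); last first.
  by rewrite hpps mulr_sumr sumrN.
rewrite -prodr_powR// -big_split/=; apply: ler_prod => i _.
rewrite mulr_ge0 ?powR_ge0//=.
move: sc; rewrite inE => /(_ i) /andP[s0 s1].
rewrite hE; last first.
  rewrite -[leLHS](@mulfV _ l) ?gt_eqF//.
  by apply: ler_pM => //; [exact: ltW|by rewrite invr_ge0 ltW].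
rewrite powRM ?(ltW x0) ?(ltW s0)//; apply: ler_wpM2l; first exact: powR_ge0.
apply: ger_powR; first by rewrite s0 ltW.
by rewrite lerN2 ler_pMl ?invr_gt0// lerDl ltW.
Qed.

(** The test functions are real and nonnegative, so the real part of the complex integral is already
    all of [S x]. *)
Let cabs_RL_ge x : 0 < x ->
  (((Gamma alpha)^-1)%:E * S x <=
   (cabs (RL alpha (fun i t => (power_tail i t)%:C) x))%:E)%E.
Proof.
move=> x0; rewrite cabs_RL EFinM; apply: lee_wpmul2l.
  by rewrite lee_fin invr_ge0 Gamma_ge0.
have Sf : S x \is a fin_num by rewrite ge0_fin_numE ?S_lty// real_RL_ge0.
rewrite -(fineK Sf) lee_fin.
apply: le_trans (Re_le_cabs _); apply: le_trans (ler_norm _).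
rewrite /cintegral/= /Rintegral le_eqVlt; apply/orP; left; apply/eqP; congr fine.
rewrite integral_mkcond; apply: eq_integral => t _.
rewrite patchE /RL_integrand -rmorph_prod -rmorphM/= /cube_kernel indicE mulrCA.
by case: ifPn => _; rewrite ?mul1r ?mul0r.
Qed.

(** Only [x >= l] is kept; there [S_ge] bounds the integrand of the norm below by a multiple of
    [x^(-(1 + e))], whose integral is explicit. *)
Lemma wLp_norm_RL_power_tail_ge l B : 1 <= l -> 0 <= B ->
  (\int[lebm]_(s in E l) (W s)%:E = B%:E)%E ->
  (((Gamma alpha)^-1 * B * (e^-1 * l `^ (- e)) `^ p^-1)%:E <=
   wLp_norm p alpha (RL alpha (fun i t => (power_tail i t)%:C)))%E.
Proof.
move=> l1 B0 intB; have l0 := lt_le_trans ltr01 l1.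
have c0 : 0 <= (Gamma alpha)^-1 by rewrite invr_ge0 Gamma_ge0.
set c := (Gamma alpha)^-1 in c0 *.
set u := RL alpha _.
have u0 x : 0 <= cabs (u x) `^ p * x `^ (- (p * alpha)) by rewrite mulr_ge0 ?powR_ge0.
have mu : measurable_fun setT (fun x : R => (cabs (u x) `^ p * x `^ (- (p * alpha)))%:E).
  apply/measurable_EFinP; apply: measurable_funM; last exact: measurable_powR.
  apply: (measurableT_comp (measurable_powR _)); apply: (@measurable_cabs R _ TR).
  by apply: cmeasurable_RL => i; apply: cmeasurable_real; exact: mh.
rewrite -[X in (X * _)%:E](@powRr1 _ (c * B)) ?mulr_ge0//.
rewrite -(@mulfV _ p) ?gt_eqF// powRrM -powRM ?mulr_ge0 ?powR_ge0 ?invr_ge0 ?(ltW e0)//.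
rewrite -poweR_EFin /wLp_norm gt0_ler_poweR ?invr_ge0 ?(ltW p0)//.
- by rewrite in_itv/= leey andbT lee_fin !mulr_ge0 ?powR_ge0 ?invr_ge0 ?(ltW e0).
- by rewrite in_itv/= leey andbT; apply: integral_ge0 => x _; rewrite lee_fin; exact: u0.
rewrite EFinM -integral_powR_itvy// -ge0_integralZl_EFin ?powR_ge0//; last 2 first.
- by move=> x _; rewrite lee_fin powR_ge0.
- by apply/measurable_EFinP/measurable_funTS; exact: measurable_powR.
apply: (@le_trans _ _ (\int[leb]_(x in `[l, +oo[)
    (cabs (u x) `^ p * x `^ (- (p * alpha)))%:E)%E).
  apply: ge0_le_integral => //.
  - by move=> x _; rewrite mule_ge0// lee_fin powR_ge0.
  - apply: emeasurable_funM => //.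
    by apply/measurable_EFinP/measurable_funTS; exact: measurable_powR.
  - exact: measurable_funTS.
  move=> x; rewrite /= in_itv/= andbT => lx; have x0 := lt_le_trans l0 lx.
  rewrite -EFinM lee_fin.
  have le1 : c * (x `^ (alpha - (1 + e) / p) * B) <= cabs (u x).
    rewrite -lee_fin; apply: le_trans (cabs_RL_ge x0).
    rewrite EFinM; apply: lee_wpmul2l; first by rewrite lee_fin.
    by rewrite EFinM -intB; exact: S_ge.
  rewrite [leLHS](_ : _ = (c * (x `^ (alpha - (1 + e) / p) * B)) `^ p *
    x `^ (- (p * alpha))).
    apply: ler_wpM2r; first exact: powR_ge0.
    by rewrite ge0_ler_powR ?nnegrE ?(ltW p0) ?mulr_ge0 ?powR_ge0 ?cabs_ge0.
  (* The weight cancels [alpha]: the exponents of [x] add up to [-(1 + e)]. *)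
  rewrite (mulrCA c) [RHS](_ : _ = (c * B) `^ p *
    (x `^ ((alpha - (1 + e) / p) * p) * x `^ (- (p * alpha)))).
    congr (_ * _); rewrite -powRD ?(gt_eqF x0) ?implybT//; congr (_ `^ _).
    by field; rewrite gt_eqF.
  by rewrite powRM ?powR_ge0 ?mulr_ge0// powRrM; ring.
apply: ge0_subset_integral => //; first exact: measurable_funTS.
- by move=> x _; rewrite lee_fin.
- by move=> x /=; rewrite !in_itv/= !andbT; exact: lt_le_trans.
Qed.

End test_functions.

(** The norms of the test functions multiply to [e^(-1/p)], which also appears on the left and
    cancels. What is left is [c B l^(-e/p) <= K]. *)
Lemma RL_lower_bound K :
  operator_bounds ps (wLp_norm p alpha) (@RL R m alpha) K ->
  (Gamma alpha)^-1 * A <= K.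
Proof.
move=> HK.
have c0 : 0 <= (Gamma alpha)^-1 by rewrite invr_ge0 Gamma_ge0.
set c := (Gamma alpha)^-1 in c0 *.
have trunc l : 1 <= l -> (c%:E * \int[lebm]_(s in E l) (W s)%:E <= K%:E)%E.
  move=> l1; have l0 := lt_le_trans ltr01 l1.
  set B := fine (\int[lebm]_(s in E l) (W s)%:E)%E.
  have intB : (\int[lebm]_(s in E l) (W s)%:E = B%:E)%E.
    rewrite /B fineK// ge0_fin_numE; last by apply: integral_ge0 => s _; rewrite lee_fin.
    apply: (@le_lt_trans _ _ A%:E); last exact: ltry.
    rewrite -intW; by apply: ge0_subset_integral => // s _; rewrite lee_fin.
  have B0 : 0 <= B.
    by rewrite -lee_fin -intB; apply: integral_ge0 => s _; rewrite lee_fin.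
  rewrite intB -EFinM lee_fin.
  (* The estimate [l^(-e/p) >= 1 - (e/p) ln l] replaces the limit in [e] by a linear error. *)
  have step e : 0 < e -> c * B * (1 - e / p * ln l) <= K.
    move=> e0.
    have J0 : 0 < e^-1 `^ p^-1 by rewrite powR_gt0// invr_gt0.
    have := HK _ (fun i => in_Lp_power_tail e0 i).
    move=> /(le_trans (wLp_norm_RL_power_tail_ge e0 l1 B0 intB)).
    rewrite (eq_bigr (fun i => (e^-1 `^ (ps i)^-1)%:E)) => [|i _]; last first.
      exact: Lp_norm_power_tail.
    rewrite prodEFin -EFinM lee_fin prodr_powR ?invr_gt0// -hpps.
    rewrite powRM ?powR_ge0 ?invr_ge0 ?(ltW e0)// mulrCA (mulrC K) ler_pM2l//.
    apply: le_trans; apply: ler_wpM2l; first by rewrite mulr_ge0.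
    rewrite -powRrM /powR gt_eqF// (le_trans _ (expR_ge1Dx _))//.
    by rewrite lerD2l le_eqVlt; apply/orP; left; apply/eqP; ring.
  have ln0 : 0 <= ln l by exact: ln_ge0.
  apply/ler_addgt0Pr => d d0.
  have X1 : 0 <= c * B * ln l / p.
    by rewrite divr_ge0 ?(ltW p0)// mulr_ge0// mulr_ge0.
  have X0 : 0 < c * B * ln l / p + 1 by rewrite ltr_wpDl.
  (* With this value of [e] the linear error is at most [d]. *)
  have e0 : 0 < d / (c * B * ln l / p + 1) by rewrite divr_gt0.
  rewrite -lerBlDr; apply: le_trans (step _ e0).
  have X0' : 0 < c * B * ln l + p by rewrite ltr_wpDl// !mulr_ge0.
  rewrite mulrBr mulr1 lerD2l lerN2.
  rewrite [leLHS](_ : _ = d * ((c * B * ln l / p) / (c * B * ln l / p + 1))); last first.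
    by field; rewrite (gt_eqF p0) (gt_eqF X0').
  by rewrite -[leRHS]mulr1 ler_wpM2l ?(ltW d0)// ler_pdivrMr// mul1r lerDl.
(* Monotone convergence along [l = n.+1], where the shift ensures [1 <= l]. *)
have cv : (c%:E * \int[lebm]_(s in E n.+1%:R) (W s)%:E @[n --> \oo] -->
    c%:E * \int[lebm]_(s in \bigcup_n E n.+1%:R) (W s)%:E)%E.
  apply: cvgeZl => //; apply: ge0_nondecreasing_set_cvg_integral => //.
  - move=> i j ij; apply/subsetPset => s sE k; apply: le_trans (sE k).
    by rewrite lef_pV2 ?posrE// ler_nat.
  - by move=> i s _; rewrite lee_fin.
have EA : (\int[lebm]_(s in \bigcup_n E n.+1%:R) (W s)%:E = A%:E)%E.
  rewrite -intW integral_mkcond; apply: eq_integral => s _.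
  rewrite patchE; case: ifPn => // sE.
  have [|sc] := boolP (s \in @cube R m 1); last by rewrite /W RL_weight_notin.
  rewrite inE => sc; move/negP: sE => []; rewrite inE.
  (* There are finitely many coordinates, all positive on the cube, so one [n] serves them all. *)
  have : \forall n \near \oo, forall i, n.+1%:R^-1 < tnth s i.
    apply: filter_forall => i; have /andP[s0 _] := sc i.
    exact: (near_infty_natSinv_lt (PosNum s0)).
  by move=> [n _ sn]; exists n => // i; apply: ltW; exact: sn (leqnn n) i.
rewrite -lee_fin EFinM -EA -(cvg_lim _ cv)//; apply: lime_le.
  by apply: cvgP; exact: cv.
by apply: nearW => n; apply: trunc; rewrite ler1n.
Qed.

End lower_bound.

(** Since [cintegral] is total, a norm bound alone would not say that the defining integrals
    converge; the almost-everywhere clause does. *)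
Theorem corollary2p1 (R : realType) (m : nat) (alpha p : R) (ps : 'I_m -> R)
    (halpha : 0 < alpha < m%:R) (hp : 1 < p) (hps : forall i, 1 < ps i)
    (hpps : p^-1 = \sum_(i < m) (ps i)^-1) :
  (forall f : 'I_m -> R -> R[i],
     (forall i, in_Lp (ps i) (f i)) ->
     {ae @lebesgue_measure R, forall x, 0 < x ->
        cintegrable (lebesgue_tuple R m) (@cube R m x) (RL_integrand alpha f x)} /\
     in_wLp p alpha (RL alpha f)) /\
  (exists2 K : R, K%:E = RL_constant alpha ps &
     is_operator_norm ps (wLp_norm p alpha) (@RL R m alpha) K).
Proof.
split=> [f hf|].
  split; first exact: (ae_RL_cintegrable halpha hp hps hpps hf).
  split; first by apply: cmeasurable_RL => i; have [] := hf i.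
  apply: (le_lt_trans (RL_upper_bound halpha hp hps hpps hf)).
  suff : (\prod_(i < m) Lp_norm (ps i) (f i))%E \is a fin_num.
    by move=> Nfin; rewrite -(fineK Nfin) -EFinM ltry.
  elim/big_ind: _ => [//|x y|i _]; first exact: fin_numM.
  by have [_ ?] := hf i; rewrite ge0_fin_numE// Lnorm_ge0.
exists ((Gamma alpha)^-1 * fine (\int[lebesgue_tuple R m]_t (RL_weight alpha ps t)%:E)%E).
  by rewrite (RL_constantE halpha hps).
split=> [f hf|K HK]; first exact: (RL_upper_bound halpha hp hps hpps hf).
exact: (RL_lower_bound halpha hp hps hpps HK).
Qed.
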